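(* $\mathsf{Asym}\in\mathsf{dAMAM}[O(\log n)]$, where $\mathsf{Asym}$ is the language of (connected) $n$-vertex communication graphs $G$ that have no non-trivial automorphism.
   Context: Distributed interactive proofs (model). An instance consists of a connected communication graph $G=(V,E)$ with $|V|=n$, where each node has a unique identifier of $O(\log n)$ bits, knows $n$, knows its own identifier, its local input (if the problem has local inputs), and the identifiers of its neighbours (with an arbitrary port numbering of its incident edges). A prover, who sees the whole instance, interacts with all nodes in $r$ alternating messages. In a verifier (node) message each node independently samples fresh uniformly random bits and sends them to the prover (public coins). In a prover message the prover sends each node a string. Nodes may additionally exchange the strings they received from the prover with their neighbours in $G$. At the end each node deterministically accepts or rejects as a function of its local information, its own random bits, the strings it received from the prover and those its neighbours received; the instance is accepted iff all nodes accept. The proof size is the maximum number of bits in any single message between the prover and any node. A language $\mathcal L$ (set of instances) is in $\mathsf{dIP}[r,\ell]$ if there is an $r$-message protocol of proof size $\ell=\ell(n)$ such that (completeness) for every instance in $\mathcal L$ some prover makes all nodes accept with probability $>2/3$, and (soundness) for every instance not in $\mathcal L$ and every prover, all nodes accept with probability $<1/3$ (probabilities over the nodes' coins). $\mathsf{dAM}[\ell]$, $\mathsf{dMAM}[\ell]$, $\mathsf{dAMAM}[\ell]$, $\mathsf{dMAMAM}[\ell]$ denote the cases of 2, 3, 4, 5 messages, where the letters indicate who sends each message in order (A = nodes send random coins, M = prover). An automorphism of $G=(V,E)$ is a permutation $\sigma$ of $V$ with $(u,v)\in E\iff(\sigma(u),\sigma(v))\in E$; it is non-trivial if it is not the identity.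 *)

(* Defs.v *)
From HB Require Import structures.
From mathcomp Require Import all_boot all_order all_algebra all_fingroup.
Set Implicit Arguments. Unset Strict Implicit. Unset Printing Implicit Defensive.
Import GRing.Theory Num.Theory.

Definition simple_graph (n : nat) (e : rel 'I_n) : Prop :=
  (forall u v, e u v = e v u) /\ (forall v, ~~ e v v).

Definition connected_graph (n : nat) (e : rel 'I_n) : Prop :=
  forall u v, connect e u v.

Definition valid_ids (cid n : nat) (id : 'I_n -> nat) : Prop :=
  injective id /\ forall v, id v < 2 ^ (cid * (trunc_log 2 n).+1).

Definition port_numbering (n : nat) (e : rel 'I_n) (port : 'I_n -> seq 'I_n) : Prop :=
  forall v, uniq (port v) /\ forall u, (u \in port v) = e v u.

(* Random coins of one verifier round: each node samples l fresh uniform bits. *)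
Definition coins (n l : nat) := {ffun 'I_n -> l.-tuple bool}.

(* A node's deterministic decision: own identifier, own coins of rounds 1 and 2,
   own prover strings of rounds 1 and 2, and, in port order, for each neighbour:
   (its identifier, its prover string of round 1, its prover string of round 2). *)
Definition decider (l : nat) :=
  nat -> l.-tuple bool -> l.-tuple bool -> seq bool -> seq bool ->
  seq (nat * seq bool * seq bool) -> bool.

Definition all_accept (n l : nat) (D : decider l) (id : 'I_n -> nat)
  (port : 'I_n -> seq 'I_n) (r1 r2 : coins n l) (m1 m2 : 'I_n -> seq bool) : bool :=
  [forall v, D (id v) (r1 v) (r2 v) (m1 v) (m2 v)
               [seq (id u, m1 u, m2 u) | u <- port v]].

(* Prover strategy in AMAM: first message depends on first coins,
   second message depends on both rounds of coins. *)
Definition prover_bounded (n l : nat) (P1 : coins n l -> 'I_n -> seq bool)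
  (P2 : coins n l -> coins n l -> 'I_n -> seq bool) : Prop :=
  (forall r1 v, size (P1 r1 v) <= l) /\ (forall r1 r2 v, size (P2 r1 r2 v) <= l).

Definition accept_prob (n l : nat) (D : decider l) (id : 'I_n -> nat)
  (port : 'I_n -> seq 'I_n) (P1 : coins n l -> 'I_n -> seq bool)
  (P2 : coins n l -> coins n l -> 'I_n -> seq bool) : rat :=
  ((#|[set rr : coins n l * coins n l |
        all_accept D id port rr.1 rr.2 (P1 rr.1) (P2 rr.1 rr.2)]|)%:R
  / (#|{: coins n l * coins n l}|)%:R)%R.

Definition language := forall n : nat, rel 'I_n -> Prop.

Definition in_dAMAM_log (L : language) : Prop :=
  forall cid : nat, exists C : nat, exists (ell : nat -> nat)
    (D : forall n, decider (ell n)),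
    (forall n, ell n <= C * (trunc_log 2 n).+1) /\
    forall (n : nat) (e : rel 'I_n) (id : 'I_n -> nat) (port : 'I_n -> seq 'I_n),
      0 < n -> simple_graph e -> connected_graph e -> valid_ids cid id ->
      port_numbering e port ->
      (L n e -> exists P1 P2, prover_bounded P1 P2 /\
                 (2%:R / 3%:R < accept_prob (D n) id port P1 P2)%R) /\
      (~ L n e -> forall P1 P2, prover_bounded P1 P2 ->
                 (accept_prob (D n) id port P1 P2 < 1%:R / 3%:R)%R).

Definition is_automorphism (n : nat) (e : rel 'I_n) (s : {perm 'I_n}) : Prop :=
  forall u v, e u v = e (s u) (s v).

Definition Asym : language :=
  fun n e => forall s : {perm 'I_n}, is_automorphism e s -> s = 1%g.

(* Main.v *)
Require Import Defs.
From HB Require Import structures.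
From mathcomp Require Import all_boot all_order all_algebra all_fingroup.
From mathcomp Require Import finfield zify ring lra.
Set Implicit Arguments. Unset Strict Implicit. Unset Printing Implicit Defensive.
Import Order.TTheory GRing.Theory Num.Theory.
Local Open Scope ring_scope.

(** The protocol is a distributed Goldwasser-Sipser set lower bound.  The set of
    [k]-tuples of relabelled copies of [G] has [n!^k] elements if [G] is asymmetric
    and at most [(n!/2)^k] otherwise.  The first coins describe a hash function and
    the prover answers with a tuple hashing into a target of density about
    [8 / n!^k]; a second-moment argument shows that one exists with probability at
    least [3/4] if [G] is asymmetric, and a union bound gives at most [1/4] otherwise.

    The hash has two stages over a field [K] with [q = poly(n)] elements.  Row [i] of
    copy [c] is compressed to the value at a random point [alpha(c, i)] of the
    polynomial whose exponents are the neighbours of [i].  A fixed tuple collides with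
    few others: a tuple differing from it exactly in a set [D] of rows is determined
    by the vertices with labels in [D], so there are at most [n^|D|] of them, each
    colliding with probability at most [(n/q)^|D|].  The resulting vector of length
    [kn] is then hashed by a random Toeplitz matrix plus a shift, that is, by the
    middle coefficients of a product of polynomials.

    Every global condition on the first prover message (the labels are permutations,
    the nodes are ranked by identifier, the coins quoted by the prover are authentic,
    the product of polynomials is correct) is an identity between polynomials whose
    coefficients are spread over the nodes.  It is tested at a random point chosen by
    a root, and the values are summed up along a tree. *)

(** Chebyshev's inequality for the number of [x] hitting a random [w]: the mean is [mu], the
    variance is at most [2 * mu], and each [w] without a hit contributes [mu ^+ 2] to the variance
    sum. *)
Lemma second_moment (X W : finType) (P : X -> W -> bool) (mu : rat) :
  0 < mu ->
  \sum_x #|[set w | P x w]|%:R = mu * #|W|%:R ->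
  \sum_x \sum_x' #|[set w | P x w && P x' w]|%:R
    <= (2%:R * mu + mu ^+ 2) * #|W|%:R ->
  mu * #|[set w | ~~ [exists x, P x w]]|%:R <= 2%:R * #|W|%:R.
Proof.
move=> mu0 H1 H2.
have cardE (Q : pred W) : #|[set w | Q w]|%:R = \sum_w (Q w)%:R :> rat.
  by rewrite cardsE -sum1_card natr_sum big_mkcond; apply: eq_bigr => w _; rewrite unfold_in; case: (Q w).
pose Z w : rat := \sum_x (P x w)%:R.
have E1 : \sum_w Z w = mu * #|W|%:R.
  by rewrite -H1 exchange_big; apply: eq_bigr => x _; rewrite cardE.
have E2 : \sum_w Z w ^+ 2 <= (2%:R * mu + mu ^+ 2) * #|W|%:R.
  suff -> : \sum_w Z w ^+ 2 = \sum_x \sum_x' #|[set w | P x w && P x' w]|%:R by [].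
  transitivity (\sum_w \sum_x \sum_x' ((P x w && P x' w)%:R : rat)).
    apply: eq_bigr => w _; rewrite expr2 mulr_suml; apply: eq_bigr => x _.
    by rewrite mulr_sumr; apply: eq_bigr => x' _; rewrite -natrM mulnb.
  rewrite exchange_big; apply: eq_bigr => x _.
  by rewrite exchange_big; apply: eq_bigr => x' _; rewrite cardE.
have E3 : mu ^+ 2 * #|[set w | ~~ [exists x, P x w]]|%:R <= \sum_w (Z w - mu) ^+ 2.
  rewrite cardE mulr_sumr; apply: ler_sum => w _.
  case: existsP => /= [_|noP]; first by rewrite mulr0 sqr_ge0.
  rewrite mulr1 /Z big1 ?sub0r ?sqrrN // => x _.
  by case Pxw: (P x w) => //; case: noP; exists x.
have E4 : \sum_w (Z w - mu) ^+ 2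
    = \sum_w Z w ^+ 2 - 2%:R * mu * \sum_w Z w + mu ^+ 2 * #|W|%:R.
  rewrite mulr_sumr -sumrB -[#|W|]sum1_card natr_sum mulr_sumr -big_split /=.
  by apply: eq_bigr => w _; ring.
rewrite -(ler_pM2l mu0).
move: E3; rewrite E4 E1 expr2; lra.
Qed.

(** * Toeplitz hashing with a random shift *)

Section LinearHash.
Variables (K : finFieldType) (M : nat).
Local Notation vec := 'rV[K]_M.

Definition split_poly (a : vec * vec) : {poly K} := rVpoly a.1 + 'X^M * rVpoly a.2.
(** With [s] the coefficients of [split_poly a], entry [i] of the middle of its product with
    [rVpoly z] is the sum over [j] of [s_(M+i-j) z_j]: a Toeplitz matrix applied to [z]. *)
Definition middle (p : {poly K}) : vec := \row_i p`_(M + i).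
Definition hash (a : vec * vec) (b z : vec) : vec := middle (split_poly a * rVpoly z) + b.

Lemma coef_split_poly_lo a (i : 'I_M) : (split_poly a)`_i = a.1 0 i.
Proof. by rewrite coefD coef_rVpoly_ord coefXnM ltn_ord addr0. Qed.

Lemma coef_split_poly_hi a (i : 'I_M) : (split_poly a)`_(M + i) = a.2 0 i.
Proof.
rewrite coefD coefXnM ltnNge leq_addr /= addKn coef_rVpoly_ord.
by rewrite coef_rVpoly; case: insubP => [j|_]; rewrite ?add0r //= => /[swap] _; lia.
Qed.

Lemma middleB p p' : middle (p - p') = middle p - middle p'.
Proof. by apply/rowP => i; rewrite !mxE coefB. Qed.

(* If [j] is the order of [d], the coefficients [M - j .. 2M - j - 1] of [split_poly a]
   are determined by the others through a triangular system. *)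
Lemma card_middle_fiber (d y : vec) : d != 0 ->
  (#|[set a | middle (split_poly a * rVpoly d) == y]| <= #|K| ^ M)%N.
Proof.
move=> d0; set p := rVpoly d.
have [j0 pj0 minj] : exists2 j0 : 'I_M, p`_j0 != 0 & forall j, (j < j0)%N -> p`_j = 0.
  have ex : exists j, (j < M)%N && (p`_j != 0).
    move/rV0Pn: d0 => [j dj]; exists j.
    by rewrite ltn_ord /p coef_rVpoly_ord.
  case: (ex_minnP ex) => j /andP[jM pj] jmin; exists (Ordinal jM) => //= i ij.
  apply/eqP; case: eqP => // /eqP pi; have := jmin i; rewrite pi andbT; lia.
pose res a : vec :=
  \row_(i < M) (split_poly a)`_(if (i < M - j0)%N then i : nat else (M + i)%N).
have -> : (#|K| ^ M = #|{: vec}|)%N by rewrite card_mx mul1n.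
apply: leq_trans (max_card (res @: [set a | middle (split_poly a * p) == y])).
rewrite card_in_imset // => a a'; rewrite !inE => /eqP ya /eqP ya' eqres.
pose g := split_poly a - split_poly a'.
have gp i : (i < M)%N -> (g * p)`_(M + i) = 0.
  move=> iM; have /rowP/(_ (Ordinal iM)) : middle (g * p) = 0.
    by rewrite mulrBl middleB ya ya' subrr.
  by rewrite !mxE.
have glow i : (i < M - j0)%N -> g`_i = 0.
  move=> iM; have iM' : (i < M)%N by lia.
  move/rowP/(_ (Ordinal iM')): eqres.
  by rewrite !mxE /= iM coefB => ->; rewrite subrr.
have ghigh i : (M - j0 <= i)%N -> (i < M)%N -> g`_(M + i) = 0.
  move=> Mi iM; move/rowP/(_ (Ordinal iM)): eqres.
  by rewrite !mxE /= ltnNge Mi /= coefB => ->; rewrite subrr.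
have j0M := ltn_ord j0.
have gmid i : (i < M)%N -> g`_(M - j0 + i) = 0.
  elim/ltn_ind: i => i IH iM; have := gp i iM; rewrite coefM.
  have lt : (M - j0 + i < (M + i).+1)%N by lia.
  rewrite (bigD1 (Ordinal lt)) //= big1 ?addr0.
    have -> : (M + i - (M - j0 + i) = j0)%N by lia.
    by move/eqP; rewrite mulf_eq0 (negPf pj0) orbF => /eqP.
  move=> l; rewrite -val_eqE /= => nl.
  have [ll|ll] := ltnP l (M - j0); first by rewrite glow ?mul0r.
  have [l2|l2] := ltnP l (M - j0 + i).
    by have := IH (l - (M - j0))%N; rewrite subnKC // => ->; rewrite ?mul0r //; lia.
  by rewrite minj ?mulr0 //; have := ltn_ord l; lia.
have g0 i : (i < M + M)%N -> g`_i = 0.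
  move=> iM; have [l1|l1] := ltnP i (M - j0); first exact: glow.
  have [l2|l2] := ltnP i (M - j0 + M).
    by rewrite -(subnKC l1) gmid //; lia.
  have -> : (i = M + (i - M))%N by lia.
  by rewrite ghigh //; lia.
case: a a' @g {ya ya' eqres gp glow ghigh gmid} g0 => [a1 a2] [b1 b2] g g0.
suff [-> ->] : a1 = b1 /\ a2 = b2 by []; split; apply/rowP => i.
  have := g0 i; rewrite /g coefB !coef_split_poly_lo /= => /(_ _)/eqP.
  by rewrite subr_eq0 => h; apply/eqP/h; have := ltn_ord i; lia.
have := g0 (M + i)%N; rewrite /g coefB !coef_split_poly_hi /= => /(_ _)/eqP.
by rewrite subr_eq0 => h; apply/eqP/h; have := ltn_ord i; lia.
Qed.

(** For a fixed key the shift acts as a translation, so the hash value of one vector is uniform. *)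
Lemma card_hash_in (T : {set vec}) (z : vec) :
  #|[set w : (vec * vec) * vec | hash w.1 w.2 z \in T]| = (#|K| ^ (M + M) * #|T|)%N.
Proof.
have <- : #|setX [set: vec * vec] T| = (#|K| ^ (M + M) * #|T|)%N.
  by rewrite cardsX cardsT card_prod card_mx mul1n expnD.
pose f (w : (vec * vec) * vec) := (w.1, hash w.1 w.2 z).
have f_inj : injective f.
  by move=> [a b] [a' b'] [<-]; rewrite /hash /= => /addrI <-.
rewrite -(card_preimset (setX setT T) f_inj).
by apply: eq_card => -[a b]; rewrite !inE.
Qed.

(** The difference of the two hash values is free of the shift and linear in [z - z']. Each pair of
    values thus leaves at most [q ^ M] keys by [card_middle_fiber], and the key then fixes the
    shift. *)
Lemma card_hash_in2 (T : {set vec}) (z z' : vec) : z != z' ->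
  (#|[set w : (vec * vec) * vec |
      (hash w.1 w.2 z \in T) && (hash w.1 w.2 z' \in T)]| <= #|T| ^ 2 * #|K| ^ M)%N.
Proof.
move=> zz'.
pose f (w : (vec * vec) * vec) := ((hash w.1 w.2 z, hash w.1 w.2 z'), w.1).
have f_inj : injective f.
  by move=> [a b] [a' b'] [+ _ ea]; rewrite /hash /= ea => /addrI <-.
pose U := [set u : (vec * vec) * (vec * vec) |
  (u.1 \in setX T T) && (middle (split_poly u.2 * rVpoly (z - z')) == u.1.1 - u.1.2)].
rewrite -(card_imset _ f_inj).
have /subset_leq_card : f @: [set w | (hash w.1 w.2 z \in T) && (hash w.1 w.2 z' \in T)]
    \subset U.
  apply/subsetP => _ /imsetP[[a b] + ->]; rewrite !inE /= => ->.
  by rewrite linearB mulrBr middleB /hash /= opprD addrACA subrr addr0.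
move/leq_trans; apply.
rewrite -sum1_card (eq_bigl (fun u => (u.1 \in setX T T) &&
  (u.2 \in [set a | middle (split_poly a * rVpoly (z - z')) == u.1.1 - u.1.2]))); last first.
  by move=> [u a]; rewrite !inE.
rewrite -(pair_big_dep (mem (setX T T)) (fun u a => a \in [set a |
   middle (split_poly a * rVpoly (z - z')) == u.1 - u.2]) (fun _ _ => 1%N)) /=.
have -> : (#|T| ^ 2 * #|K| ^ M = \sum_(u in setX T T) #|K| ^ M)%N.
  by rewrite sum_nat_const cardsX.
apply: leq_sum => u _; rewrite sum1_card; apply: card_middle_fiber.
by rewrite subr_eq0.
Qed.

End LinearHash.

(** * Boxes of prescribed density *)

Lemma card_ffun_forall (I C : finType) (P : I -> pred C) :
  #|[set f : {ffun I -> C} | [forall i, P i (f i)]]| = (\prod_i #|P i|)%N.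
Proof.
have -> : #|[set f : {ffun I -> C} | [forall i, P i (f i)]]| = #|family P|.
  apply: eq_card => f; rewrite inE.
  by apply/forallP/familyP => h i; have := h i.
by rewrite card_family foldrE big_map big_enum.
Qed.

Section Box.
Variables (K : finFieldType) (M : nat).

(** The target is a product set so that each node can test its own coordinates locally. *)
Definition box (B : {ffun 'I_M -> {set K}}) : {set 'rV[K]_M} :=
  [set y : 'rV[K]_M | [forall m, y 0 m \in B m]].

Lemma card_box B : #|box B| = (\prod_m #|B m|)%N.
Proof.
rewrite -(card_ffun_forall (fun m => mem (B m))).
pose f (y : 'rV[K]_M) := [ffun m => y 0 m].
have f_inj : injective f.
  by move=> y y' /ffunP h; apply/rowP => m; have := h m; rewrite !ffunE.
rewrite -(card_imset _ f_inj); apply: eq_card => g; rewrite inE.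
apply/imsetP/forallP => [[y + ->] m|gB].
  by rewrite inE => /forallP/(_ m); rewrite /= ffunE.
exists (\row_m g m); last by apply/ffunP => m; rewrite !ffunE mxE.
by rewrite inE; apply/forallP => m; rewrite mxE; apply: gB.
Qed.

Lemma exists_set_card (s : nat) : (s <= #|K|)%N -> exists B : {set K}, #|B| = s.
Proof.
move=> sK; exists [set x in take s (enum K)].
rewrite cardsE; have /card_uniqP -> := take_uniq s (enum_uniq K).
by rewrite size_takel // -cardE.
Qed.

End Box.

(** Some sides are full, one is rounded and the others have length 1; the rounding is absorbed by
    the factor 2 between the bounds. *)
Lemma exists_prod_between (q F M : nat) : (8 <= F)%N -> (F <= 8 * q ^ M)%N ->
  exists s : 'I_M -> nat, (forall i, (s i <= q)%N) /\
    (8 * q ^ M <= (\prod_i s i) * F <= 16 * q ^ M)%N.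
Proof.
move=> F8; elim: M => [|M IH] FM.
  exists (fun=> 1%N); split; first by case.
  by rewrite big_ord0; move: FM; rewrite expn0; lia.
have q0 : (0 < q)%N by case: q FM {IH} => //; rewrite exp0n //; lia.
have [FM'|FM'] := leqP F (8 * q ^ M).
  have [s [sq sF]] := IH FM'.
  exists (fun i => if unlift ord_max i is Some j then s j else q); split.
    by move=> i; case: unliftP.
  rewrite big_ord_recr /= unlift_none expnSr.
  rewrite (eq_bigr s); last first.
    move=> i _; have -> : widen_ord (leqnSn M) i = lift ord_max i.
      by apply: val_inj; rewrite /= /bump leqNgt ltn_ord.
    by rewrite liftK.
  by rewrite mulnAC !mulnA !leq_pmul2r.
(* Division rounded up: [t <= q] because [F] exceeds [8 * q ^ M], and the excess is below
   [F <= 8 * q ^ M.+1]. *)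
pose t := ((8 * q ^ M.+1 + F.-1) %/ F)%N.
have t1 : (8 * q ^ M.+1 <= t * F)%N.
  have := divn_eq (8 * q ^ M.+1 + F.-1) F.
  by have := ltn_mod (8 * q ^ M.+1 + F.-1) F; rewrite /t; lia.
have t2 : (t * F <= 8 * q ^ M.+1 + F.-1)%N by apply: leq_trunc_div.
exists (fun i => if i == ord_max then t else 1%N); split.
  move=> i; case: ifP => _; last by [].
  rewrite -ltnS ltn_divLR; last by lia.
  by move: FM'; rewrite expnSr mulnA mulSn => FM'; have := leq_mul FM' (leqnn q); lia.
rewrite big_ord_recr /= eqxx big1 ?mul1n.
  by rewrite t1 /=; lia.
by move=> i _; rewrite -val_eqE /= ltn_eqF.
Qed.

Lemma exists_box (K : finFieldType) (M F : nat) :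
  (8 <= F)%N -> (F <= 8 * #|K| ^ M)%N ->
  exists B : {ffun 'I_M -> {set K}},
    (8 * #|K| ^ M <= #|box B| * F <= 16 * #|K| ^ M)%N.
Proof.
move=> F8 FK; have [s [sK sF]] := exists_prod_between F8 FK.
have [f fP] := fin_all_exists (fun i => exists_set_card (sK i)).
exists (finfun f); rewrite card_box.
by under eq_bigr do rewrite ffunE fP.
Qed.

Lemma prod_if_in (I : finType) (D : {set I}) (a b : nat) :
  (\prod_i (if i \in D then a else b) = a ^ #|D| * b ^ #|~: D|)%N.
Proof.
rewrite (bigID (mem D)) /=; congr (_ * _)%N.
  by rewrite -prod_nat_const; apply: eq_bigr => i ->.
rewrite -prod_nat_const (eq_bigl (mem (~: D))) => [|i]; last by rewrite !inE.
by apply: eq_bigr => i; rewrite /= in_setC; case: (i \in D).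
Qed.

(** * Row sketches and their collisions *)

Section Sketch.
Variables (K : finFieldType) (k n : nat) (e : rel 'I_n).
Local Notation q := #|K|.
Local Notation labelling := {ffun 'I_k -> {perm 'I_n}}.

(* [tau c i] is the vertex carrying label [i] in the [c]-th relabelled copy *)
Definition row_poly (tau : labelling) (m : 'I_k * 'I_n) : {poly K} :=
  \sum_(j | e (tau m.1 m.2) (tau m.1 j)) 'X^j.

Definition sketch (al : {ffun 'I_k * 'I_n -> K}) (tau : labelling) : 'rV[K]_(k * n) :=
  mxvec (\matrix_(c, i) (row_poly tau (c, i)).[al (c, i)]).

Lemma coef_row_poly tau m (j : 'I_n) :
  (row_poly tau m)`_j = (e (tau m.1 m.2) (tau m.1 j))%:R.
Proof.
rewrite coef_sum (eq_bigr (fun i : 'I_n => (j == i)%:R)); last first.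
  by move=> i _; rewrite coefXn val_eqE.
rewrite big_mkcond (bigD1 j) //= eqxx big1 ?addr0 => [|i ij]; first by case: ifP.
by rewrite eq_sym (negPf ij); case: ifP.
Qed.

Lemma size_row_poly tau m : (size (row_poly tau m) <= n)%N.
Proof.
apply: (big_ind (fun p : {poly K} => size p <= n)%N) => [|p p' sp sp'|j _].
- by rewrite size_poly0.
- by rewrite (leq_trans (size_polyD _ _)) // geq_max sp.
- by rewrite size_polyXn.
Qed.

Lemma row_polyP tau tau' m : row_poly tau m = row_poly tau' m <->
  forall j, e (tau m.1 m.2) (tau m.1 j) = e (tau' m.1 m.2) (tau' m.1 j).
Proof.
split=> [eqp j|eqe].
  have := coef_row_poly tau m j; rewrite eqp coef_row_poly.
  by case: (e _ _); case: (e _ _) => // /eqP; rewrite ?oner_eq0 // eq_sym oner_eq0.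
by apply: eq_bigl => j.
Qed.

(** A differing row gives a nonzero polynomial of size at most [n], hence fewer than [n] bad points;
    the points of distinct rows are chosen independently. *)
Lemma card_sketch_eq tau tau' :
  (#|[set al | sketch al tau == sketch al tau']|
     <= \prod_m (if row_poly tau m == row_poly tau' m then q else n))%N.
Proof.
pose P m : pred K := fun x => (row_poly tau m).[x] == (row_poly tau' m).[x].
have -> : #|[set al | sketch al tau == sketch al tau']| =
          #|[set al : {ffun _ -> _} | [forall m, P m (al m)]]|.
  apply: eq_card => al; rewrite !inE (can_eq mxvecK).
  apply/eqP/forallP => [/matrixP h [c i]|h].
    by have := h c i; rewrite !mxE /P => ->.
  by apply/matrixP => c i; rewrite !mxE; apply/eqP/(h (c, i)).
rewrite card_ffun_forall; apply: leq_prod => m _.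
case: eqP => [_|/eqP ne]; first exact: max_card.
have nz : row_poly tau m - row_poly tau' m != 0 by rewrite subr_eq0.
have := max_poly_roots nz (_ : all _ (enum (P m))) (enum_uniq _).
rewrite -cardE => h; apply: leq_trans (ltnW (h _)) _.
  apply/allP => x; rewrite mem_enum /root hornerE hornerN subr_eq0.
  by rewrite unfold_in.
rewrite (leq_trans (size_polyD _ _)) // size_polyN geq_max.
by rewrite !size_row_poly.
Qed.

Hypotheses (e_sym : forall u v, e u v = e v u) (n0 : (0 < n)%N).

(** Rows outside [D] agree with those of [tau]. If two such labellings place the same vertices at
    the labels in [D], all adjacencies agree, mixed pairs being read from the row outside [D] by
    symmetry. They then differ by automorphisms, which are trivial. *)
Lemma card_labelling_diff (D : {set 'I_k * 'I_n}) tau : Asym e ->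
  (#|[set tau' | [set m | row_poly tau m != row_poly tau' m] == D]| <= n ^ #|D|)%N.
Proof.
move=> asym.
pose o : 'I_n := Ordinal n0.
pose f (t : labelling) : {ffun 'I_k * 'I_n -> 'I_n} :=
  [ffun m => if m \in D then t m.1 m.2 else o].
rewrite -[X in (_ <= X ^ _)%N](card_ord n) -(card_pffun_on o (mem D) predT).
rewrite -(card_in_imset (f := f)); last first.
  move=> t t'; rewrite !inE => /eqP Dt /eqP Dt' /ffunP eqf.
  have row m : m \notin D -> row_poly t m = row_poly t' m.
    move=> mD; have := mD; rewrite -{1}Dt inE negbK => /eqP <-.
    by have := mD; rewrite -{1}Dt' inE negbK => /eqP <-.
  have eqD m : m \in D -> t m.1 m.2 = t' m.1 m.2.
    by move=> mD; have := eqf m; rewrite !ffunE mD.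
  have eqe c i j : e (t c i) (t c j) = e (t' c i) (t' c j).
    have [iD|/row/row_polyP/(_ j) //] := boolP ((c, i) \in D).
    have [jD|/row/row_polyP/(_ i) /= h] := boolP ((c, j) \in D).
      by have /= -> := eqD _ iD; have /= -> := eqD _ jD.
    by rewrite e_sym h e_sym.
  apply/ffunP => c; have /asym : is_automorphism e ((t c)^-1 * t' c)%g.
    by move=> u v; rewrite !permM -eqe !permKV.
  by move/eqP; rewrite -eq_mulVg1 => /eqP.
apply/subset_leq_card/subsetP => _ /imsetP[t _ ->].
apply/pffun_onP; split; last by [].
by apply/supportP => m mD; rewrite ffunE (negPf mD).
Qed.

(** Grouping by the set [D] of differing rows gives at most [n^|D|] labellings with
    [n^|D| q^(kn-|D|)] colliding points each; these terms sum to a binomial expansion. *)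
Lemma sum_card_sketch_eq tau : Asym e ->
  (\sum_tau' #|[set al | sketch al tau == sketch al tau']| <= (q + n ^ 2) ^ (k * n))%N.
Proof.
move=> asym; pose diff tau' := [set m | row_poly tau m != row_poly tau' m].
have -> : ((q + n ^ 2) ^ (k * n) =
    \sum_(D : {set 'I_k * 'I_n}) n ^ #|D| * (n ^ #|D| * q ^ #|~: D|))%N.
  have -> : (k * n = #|{: 'I_k * 'I_n}|)%N by rewrite card_prod !card_ord.
  rewrite addnC -prod_nat_const bigA_distr; apply: eq_bigr => D _.
  by rewrite prod_if_in mulnA -expnMn.
rewrite (partition_big diff xpredT) //=; apply: leq_sum => D _.
apply: leq_trans (leq_mul (card_labelling_diff D tau asym) (leqnn _)).
rewrite -sum_nat_const [leqRHS](eq_bigl (fun t => diff t == D)); last first.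
  by move=> t; rewrite inE.
apply: leq_sum => t /eqP Dt.
apply: leq_trans (card_sketch_eq _ _) _.
rewrite -prod_if_in; apply: leq_prod => m _.
by rewrite -Dt inE; case: ifP.
Qed.

End Sketch.

(** * Elementary counting bounds *)

Lemma card_set_pair (A B : finType) (P : A -> B -> bool) :
  #|[set w : A * B | P w.1 w.2]| = (\sum_a #|[set b | P a b]|)%N.
Proof.
rewrite -sum1_card (eq_bigl (fun w : A * B => true && P w.1 w.2)); last first.
  by move=> w; rewrite inE.
rewrite -(pair_big_dep xpredT P (fun _ _ => 1%N)); apply: eq_bigr => a _.
by rewrite sum1dep_card.
Qed.

Lemma card_bigcup_le (I T : finType) (P : pred I) (F : I -> {set T}) :
  (#|\bigcup_(i | P i) F i| <= \sum_(i | P i) #|F i|)%N.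
Proof.
elim/big_ind2: _ => [|A m A' m' Am Am'|//]; first by rewrite cards0.
by rewrite cardsU (leq_trans (leq_subr _ _)) ?leq_add.
Qed.

(** By induction [(1 + x/q)^m (1 - m x/q) <= 1], and the second factor is at least 1/2 at
    [m = M]. *)
Lemma expnD_le2 (q x M : nat) : (2 * (M * x) <= q)%N -> ((q + x) ^ M <= 2 * q ^ M)%N.
Proof.
move=> Mx; have [q0|q0] := posnP q.
  rewrite q0 in Mx *.
  case: M Mx => [|M] Mx; first by rewrite !expn0.
  have -> : x = 0%N by nia.
  by rewrite addn0 exp0n.
have H m : (m <= M)%N -> ((q + x) ^ m * (q - m * x) <= q ^ m.+1)%N.
  elim: m => [|m IH] mM; first by rewrite mul0n subn0 expn0 mul1n expn1.
  have {}IH := IH (ltnW mM).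
  rewrite [(q ^ m.+2)%N]expnSr; apply: leq_trans (leq_mul IH (leqnn q)).
  rewrite expnSr -!mulnA leq_mul2l; apply/orP; right.
  have : (m.+1 * x <= M * x)%N by rewrite leq_mul2r mM orbT.
  rewrite mulSn; move: (m * x)%N => y h.
  have -> : (q - y = (q - (x + y)) + x)%N by lia.
  have : (q - (x + y) <= q)%N by lia.
  by move: (q - (x + y))%N => z; nia.
have := H M (leqnn M); rewrite expnS => HM.
rewrite -(leq_pmul2r q0); apply: leq_trans (_ : (2 * ((q + x) ^ M * (q - M * x)) <= _)%N).
  rewrite mulnCA leq_mul2l; apply/orP; right; lia.
by rewrite -mulnA leq_mul2l /= [(q ^ M * q)%N]mulnC.
Qed.

(** Every non-empty fibre of [f] contains some [x] together with [g x]. *)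
Lemma double_card_imset (A B : finType) (f : A -> B) (g : A -> A) :
  (forall x, g x != x) -> (forall x, f (g x) = f x) ->
  (2 * #|f @: [set: A]| <= #|A|)%N.
Proof.
move=> gx fg.
have -> : (#|A| = \sum_(y in f @: [set: A]) #|[set x | f x == y]|)%N.
  rewrite -sum1_card (partition_big f (mem (f @: [set: A]))) /=; last first.
    by move=> x _; rewrite imset_f.
  by apply: eq_bigr => y _; rewrite sum1dep_card.
rewrite mulnC -sum_nat_const; apply: leq_sum => _ /imsetP[x _ ->].
have <- : #|[set x; g x]| = 2%N by rewrite cards2 eq_sym gx.
by apply/subset_leq_card/subsetP => z; rewrite !inE => /orP[] /eqP ->; rewrite ?fg.
Qed.

(** * The set lower bound *)

Section SetLowerBound.
Variables (K : finFieldType) (k n : nat) (e : rel 'I_n) (B : {ffun 'I_(k * n) -> {set K}}).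
Local Notation q := #|K|.
Local Notation M := (k * n)%N.
Local Notation vec := 'rV[K]_M.
Local Notation labelling := {ffun 'I_k -> {perm 'I_n}}.
Local Notation W := ({ffun 'I_k * 'I_n -> K} * ((vec * vec) * vec))%type.

Definition hit (w : W) (tau : labelling) : bool :=
  hash w.2.1 w.2.2 (sketch e w.1 tau) \in box B.

Hypotheses (box_card : (8 * q ^ M <= #|box B| * n`! ^ k <= 16 * q ^ M)%N).

Lemma card_labelling : #|{: labelling}| = (n`! ^ k)%N.
Proof.
by rewrite card_ffun card_ord card_Sn.
Qed.

Lemma card_alpha : #|{: {ffun 'I_k * 'I_n -> K}}| = (q ^ M)%N.
Proof. by rewrite card_ffun card_prod !card_ord. Qed.

Lemma card_seed : #|{: W}| = (q ^ M * q ^ (M + M) * q ^ M)%N.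
Proof. by rewrite card_prod card_alpha !card_prod card_mx mul1n expnD !mulnA. Qed.

Lemma card_hit tau : #|[set w | hit w tau]| = (q ^ M * (q ^ (M + M) * #|box B|))%N.
Proof.
rewrite (card_set_pair (fun al ab => hash ab.1 ab.2 (sketch e al tau) \in box B)).
under eq_bigr do rewrite card_hash_in.
by rewrite sum_nat_const card_alpha.
Qed.

(** Where the sketches collide, the joint event is a single hash event; elsewhere [card_hash_in2]
    applies. *)
Lemma card_hit2 tau tau' :
  (#|[set w | hit w tau && hit w tau']| <=
   #|[set al : {ffun 'I_k * 'I_n -> K} | sketch e al tau == sketch e al tau']| * (q ^ (M + M) * #|box B|)
   + q ^ M * (#|box B| ^ 2 * q ^ M))%N.
Proof.
rewrite (card_set_pair (fun al ab => (hash ab.1 ab.2 (sketch e al tau) \in box B) &&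
  (hash ab.1 ab.2 (sketch e al tau') \in box B))).
rewrite -{1}card_alpha -!sum_nat_const [X in (_ <= X + _)%N]big_mkcond -big_split /=.
apply: leq_sum => al _; rewrite inE; case: eqP => [->|/eqP ne].
  apply: leq_trans (leq_addr _ _).
  by under eq_finset do rewrite andbb; rewrite card_hash_in.
by rewrite add0n card_hash_in2.
Qed.

Lemma most_seeds_hit : (forall u v, e u v = e v u) -> (0 < n)%N ->
  (2 * (M * n ^ 2) <= q)%N -> Asym e ->
  (4 * #|[set w | ~~ [exists tau, hit w tau]]| <= #|{: W}|)%N.
Proof.
move=> e_sym n0 qM asym.
have q0 : (q%:R : rat) != 0 by rewrite pnatr_eq0 -lt0n (cardD1 0).
have qM0 : (0 : rat) < q%:R ^+ M by rewrite exprn_gt0 // lt0r q0 ler0n.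
set S : rat := (q ^ M)%:R.
have S0 : 0 < S by rewrite /S natrX.
pose F : rat := (n`! ^ k)%:R; pose t : rat := #|box B|%:R.
have /andP[tF1 tF2] : 8%:R * S <= t * F <= 16%:R * S.
  by rewrite /S /t /F -!natrM !ler_nat.
(* The expected number of hitting labellings; being at least 8, it turns the failure bound [2 / mu]
   into 1/4. *)
pose mu : rat := t * F / S.
have mu8 : 8%:R <= mu by rewrite /mu ler_pdivlMr.
have WE : #|{: W}|%:R = S ^+ 4 by rewrite card_seed expnD !natrM /S; ring.
have muS : mu * S = t * F by rewrite /mu divfK ?gt_eqF.
suff : mu * #|[set w | ~~ [exists tau, hit w tau]]|%:R <= 2%:R * #|{: W}|%:R.
  rewrite -(ler_nat rat) natrM; move: (#|[set w | _]|%:R) (ler0n rat #|[set w | ~~ [exists tau, hit w tau]]|).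
  by move=> N N0; nra.
apply: (second_moment (P := fun tau w => hit w tau)); first lra.
  under eq_bigr do rewrite card_hit.
  rewrite sumr_const card_labelling WE -[LHS]mulr_natr -/F expnD !natrM -/S -/t.
  have -> : mu * S ^+ 4 = (mu * S) * S ^+ 3 by ring.
  by rewrite muS; ring.
apply: le_trans (_ : \sum_(tau : labelling) (2%:R * S ^+ 3 * t + F * S ^+ 2 * t ^+ 2) <= _);
  last first.
  rewrite sumr_const card_labelling WE -[leLHS]mulr_natr -/F.
  have -> : (2%:R * mu + mu ^+ 2) * S ^+ 4 = 2%:R * (mu * S) * S ^+ 3 + (mu * S) ^+ 2 * S ^+ 2.
    by ring.
  by rewrite muS le_eqVlt; apply/orP; left; apply/eqP; ring.
apply: ler_sum => tau _.
pose cl tau' := #|[set al : {ffun 'I_k * 'I_n -> K} | sketch e al tau == sketch e al tau']|.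
apply: le_trans (_ : \sum_(tau' : labelling)
   ((cl tau')%:R * (S ^+ 2 * t) + S ^+ 2 * t ^+ 2) <= _).
  apply: ler_sum => tau' _; have := card_hit2 tau tau'.
  rewrite -(ler_nat rat) expnD natrD !natrM -/S -/t -/(cl tau').
  move/le_trans; apply.
  by rewrite le_eqVlt; apply/orP; left; apply/eqP; ring.
rewrite big_split /= -mulr_suml -natr_sum sumr_const card_labelling.
rewrite -[X in _ + X]mulr_natr -/F.
(* All collisions together cost at most twice the [q ^ M] of the diagonal pair, which yields the
   term [2 * mu]. *)
have : (\sum_tau' cl tau' <= 2 * q ^ M)%N.
  by apply: leq_trans (sum_card_sketch_eq K e_sym n0 tau asym) (expnD_le2 qM).
rewrite -(ler_nat rat) natrM -/S => h.
have t0 : 0 <= t by rewrite ler0n.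
have : (\sum_tau' cl tau')%:R * (S ^+ 2 * t) <= 2%:R * S * (S ^+ 2 * t).
  by rewrite ler_wpM2r // mulr_ge0 // exprn_ge0 // ltW.
move: ((\sum_tau' cl tau')%:R) => N; move: h => _; rewrite exprS.
by move=> h; apply: le_trans (lerD h (lexx _)) _; rewrite le_eqVlt; apply/orP; left; apply/eqP; ring.
Qed.

Definition graph_of (s : {perm 'I_n}) : {ffun 'I_n * 'I_n -> bool} :=
  [ffun p => e (s p.1) (s p.2)].

Lemma card_graph_of (s : {perm 'I_n}) : is_automorphism e s -> s != 1%g ->
  (2 * #|graph_of @: [set: {perm 'I_n}]| <= n`!)%N.
Proof.
move=> aut s1.
rewrite -(card_Sn n); apply: (double_card_imset (g := fun x => (x * s)%g)) => x.
  by rewrite -[X in _ != X]mulg1 (inj_eq (mulgI x)).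
by apply/ffunP => p; rewrite !ffunE !permM -aut.
Qed.

(** The sketch depends on [tau] only through its [k] relabelled graphs, and composition with [s]
    saves a factor 2 in each copy. *)
Lemma card_sketch (s : {perm 'I_n}) (al : {ffun 'I_k * 'I_n -> K}) : is_automorphism e s -> s != 1%g ->
  (2 ^ k * #|sketch e al @: [set: labelling]| <= n`! ^ k)%N.
Proof.
move=> aut s1.
pose gs : {set {ffun 'I_k -> {ffun 'I_n * 'I_n -> bool}}} :=
  [set g : {ffun _ -> _} | [forall c, g c \in graph_of @: [set: {perm 'I_n}]]].
pose h (g : {ffun 'I_k -> {ffun 'I_n * 'I_n -> bool}}) : vec :=
  mxvec (\matrix_(c, i) (\sum_(j | g c (i, j)) 'X^j : {poly K}).[al (c, i)]).
have sub : sketch e al @: [set: labelling] \subset h @: gs.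
  apply/subsetP => _ /imsetP[tau _ ->]; apply/imsetP.
  exists [ffun c => graph_of (tau c)].
    by rewrite inE; apply/forallP => c; rewrite ffunE imset_f.
  congr mxvec; apply/matrixP => c i; rewrite !mxE; congr horner.
  by apply: eq_bigl => j; rewrite !ffunE.
apply: leq_trans (leq_mul (leqnn _) (leq_trans (subset_leq_card sub) (leq_imset_card _ _))) _.
rewrite (card_ffun_forall (fun c => mem (graph_of @: [set: {perm 'I_n}]))).
rewrite prod_nat_const card_ord -expnMn.
have [k0|k0] := posnP k; first by rewrite k0 !expn0.
by rewrite leq_exp2r ?(card_graph_of aut).
Qed.

(** Union bound over distinct sketches: at most [n!^k / 64] of them, each landing in a box of
    density at most [16 / n!^k]. *)
Lemma few_seeds_hit : (64 <= 2 ^ k)%N -> ~ Asym e ->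
  (4 * #|[set w | [exists tau, hit w tau]]| <= #|{: W}|)%N.
Proof.
move=> k64 nasym.
have [s /andP[/forallP aut s1]] : exists s : {perm 'I_n},
    [forall u, forall v, e u v == e (s u) (s v)] && (s != 1%g).
  apply/existsP; apply: contra_notT nasym => /existsPn h s aut.
  apply/eqP; have := h s; rewrite negb_and negbK => /orP[/negP[]|//].
  by apply/forallP => u; apply/forallP => v; rewrite -aut.
have {}aut : is_automorphism e s by move=> u v; apply/eqP/(forallP (aut u)).
rewrite (card_set_pair (fun al ab => [exists tau, hit (al, ab) tau])).
apply: leq_trans (_ : 4 * \sum_(al : {ffun 'I_k * 'I_n -> K})
   (#|sketch e al @: [set: labelling]| * (q ^ (M + M) * #|box B|)) <= _)%N.
  rewrite leq_mul2l; apply: leq_sum => al _.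
  have sub : [set ab | [exists tau, hit (al, ab) tau]] \subset
     \bigcup_(z in sketch e al @: [set: labelling])
       [set ab : (vec * vec) * vec | hash ab.1 ab.2 z \in box B].
    apply/subsetP => ab; rewrite inE => /existsP[tau ht].
    by apply/bigcupP; exists (sketch e al tau); rewrite ?imset_f // inE.
  apply: leq_trans (subset_leq_card sub) _.
  apply: leq_trans (card_bigcup_le _ _) _.
  rewrite -sum_nat_const; apply: leq_sum => z _; by rewrite card_hash_in.
rewrite -(leq_pmul2l (_ : 0 < 16)%N) // mulnA.
apply: leq_trans (_ : 2 ^ k * \sum_(al : {ffun 'I_k * 'I_n -> K})
   (#|sketch e al @: [set: labelling]| * (q ^ (M + M) * #|box B|)) <= _)%N.
  by rewrite leq_mul2r k64 orbT.
rewrite big_distrr /=.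
apply: leq_trans (_ : \sum_(al : {ffun 'I_k * 'I_n -> K})
   (n`! ^ k * (q ^ (M + M) * #|box B|)) <= _)%N.
  by apply: leq_sum => al _; rewrite mulnA leq_mul2r (card_sketch _ aut s1) orbT.
rewrite sum_nat_const card_alpha card_seed.
have /andP[_ h] := box_card.
have -> : (q ^ M * (n`! ^ k * (q ^ (M + M) * #|box B|)) =
   q ^ M * q ^ (M + M) * (#|box B| * n`! ^ k))%N by ring.
by rewrite [leqRHS]mulnCA leq_mul2l h orbT.
Qed.

End SetLowerBound.

(** * Summation along a spanning tree *)

Section TreeSum.
Variables (V : zmodType) (n : nat) (e : rel 'I_n) (id : 'I_n -> nat).
Hypotheses (e_sym : forall u v, e u v = e v u) (id_inj : injective id).
Variables (par d : 'I_n -> nat).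

Definition child (v u : 'I_n) : bool := [&& e v u, par u == id v & d u == (d v).+1].

Hypothesis parP :
  forall v, d v != 0 -> exists2 u, e v u & (id u == par v) && (d v == (d u).+1).

Lemma sum_child (S : 'I_n -> V) :
  \sum_v \sum_(u | child v u) S u = \sum_(u | d u != 0) S u.
Proof.
rewrite (exchange_big_dep xpredT) //= [RHS]big_mkcond; apply: eq_bigr => u _.
case: eqP => [du|/eqP/parP[v euv /andP[/eqP idv duv]]] /=.
  by rewrite big1 // => v; rewrite /child du andbF andbF.
rewrite (big_pred1 v) // => w; rewrite /child -idv (inj_eq id_inj) /=.
by case: eqVneq => [<-|]; rewrite ?andbF // e_sym euv duv.
Qed.

(** Summing the local equations over all nodes, each [S u] with [d u != 0] appears once under its
    unique parent and cancels; the nodes at distance 0 contribute zero. *)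
Lemma tree_sum0 (S f : 'I_n -> V) :
  (forall v, S v = f v + \sum_(u | child v u) S u) ->
  (forall v, d v = 0 -> S v = 0) -> \sum_v f v = 0.
Proof.
move=> SE S0; have : \sum_v S v = \sum_v f v + \sum_(u | d u != 0) S u.
  by rewrite -sum_child -big_split; apply: eq_bigr => v _; apply: SE.
rewrite (bigID (fun u => d u != 0)) /= addrC => /addIr <-.
by rewrite big1 // => v /negPn/eqP/S0.
Qed.

Variables (root : 'I_n) (f : 'I_n -> V).
Hypotheses (d_bound : forall v, (d v < n)%N) (rootP : forall v, (d v == 0) = (v == root)).

Definition subtree_step (S : 'I_n -> V) v := f v + \sum_(u | child v u) S u.

Definition subtree_sum : 'I_n -> V := iter n subtree_step (fun=> 0).

(** A node at distance [d] is stable after [n - d] rounds, since its children lie one level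
    deeper. *)
Lemma subtree_sumE v : subtree_sum v = f v + \sum_(u | child v u) subtree_sum u.
Proof.
suff H m w : (n <= d w + m)%N ->
    iter m.+1 subtree_step (fun=> 0) w = iter m subtree_step (fun=> 0) w.
  by rewrite -[LHS]H ?leq_addl.
elim: m w => [|m IH] w; first by rewrite addn0 leqNgt d_bound.
move=> dw; rewrite iterS [in RHS]iterS /subtree_step; congr (_ + _).
apply: eq_bigr => u /and3P[_ _ /eqP du]; apply: IH; lia.
Qed.

Lemma subtree_sum_root : \sum_v f v = 0 -> subtree_sum root = 0.
Proof.
move=> f0; have : \sum_v subtree_sum v = \sum_v f v + \sum_(u | d u != 0) subtree_sum u.
  by rewrite -sum_child -big_split; apply: eq_bigr => v _; apply: subtree_sumE.
rewrite f0 add0r (bigID (fun u => d u != 0)) /= -[RHS]addr0 => /addrI.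
by rewrite (big_pred1 root) // => v; rewrite negbK rootP.
Qed.

End TreeSum.

Lemma bfs_tree (n : nat) (e : rel 'I_n) (root : 'I_n) :
  (forall u v, e u v = e v u) -> connected_graph e ->
  exists (d p : 'I_n -> 'I_n), d root = 0 :> nat /\
    forall v, v != root -> e v (p v) /\ d v = (d (p v)).+1 :> nat.
Proof.
move=> e_sym conn.
pose P v m := [exists s : m.-tuple 'I_n, path e root s && (last root s == v)].
have exP v : exists m, P v m && (m < n)%N.
  have /connectP[s es ->] := conn root v.
  case/shortenP: es => s' es' us' _.
  exists (size s'); apply/andP; split.
    by apply/existsP; exists (in_tuple s'); rewrite es' eqxx.
  by have := max_card (mem (root :: s')); rewrite (card_uniqP us') card_ord.
pose dn v := ex_minn (exP v).
have dnP v : P v (dn v) && (dn v < n)%N by rewrite /dn; case: ex_minnP.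
have dn_min v m : P v m -> (dn v <= m)%N.
  move=> Pm; have [mn|mn] := ltnP m n.
    by rewrite /dn; case: ex_minnP => j _; apply; rewrite Pm mn.
  by have /andP[_ h] := dnP v; rewrite ltnW // (leq_trans h).
have dn0 : dn root = 0%N.
  by apply/eqP; rewrite -leqn0; apply: dn_min; apply/existsP; exists [tuple]; rewrite /= eqxx.
have step v : v != root -> exists u, e v u /\ dn v = (dn u).+1.
  have /andP[/existsP[[s ss] /= /andP[es /eqP ls]] _] := dnP v.
  case/lastP: s ss es ls => [|s w] ss es ls; first by rewrite -ls eqxx.
  move=> _; move: ls; rewrite last_rcons => wv; rewrite {}wv in ss es.
  move: es; rewrite rcons_path => /andP[es eu]; exists (last root s).
  split; first by rewrite e_sym.
  move: ss; rewrite size_rcons => /eqP dv; rewrite -dv; apply/eqP; rewrite eqSS eqn_leq.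
  apply/andP; split.
    rewrite -ltnS; have /andP[/existsP[s' /andP[es' /eqP ls']] _] := dnP (last root s).
    rewrite dv; apply: dn_min; apply/existsP; exists [tuple of rcons s' v].
    by rewrite rcons_path last_rcons es' ls' eu /= eqxx.
  by apply: dn_min; apply/existsP; exists (in_tuple s); rewrite es eqxx.
have exists_parent v : exists u, v != root -> e v u /\ dn v = (dn u).+1.
  by have [->|/step[u]] := eqVneq v root; [exists root | exists u].
have [p pP] := fin_all_exists (fun v => exists_parent v).
exists (fun v => Ordinal (proj2 (andP (dnP v)))), p; split=> //= v; exact: pP.
Qed.

(** * Ranking by identifiers *)

Section Rank.
Variables (n : nat) (id : 'I_n -> nat).
Hypothesis id_inj : injective id.

Lemma rank_subproof v : (#|[set u | (id u < id v)%N]| < n)%N.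
Proof.
rewrite -[X in (_ < X)%N](card_ord n) -cardsT; apply: proper_card.
by rewrite properT; apply/eqP => /setP/(_ v); rewrite !inE ltnn.
Qed.

Definition rank v : 'I_n := Ordinal (rank_subproof v).

Lemma ltn_rank u v : (rank u < rank v)%N = (id u < id v)%N.
Proof.
have H a b : (id a <= id b)%N -> (rank a <= rank b)%N.
  move=> ab; apply/subset_leq_card/subsetP => w; rewrite !inE => /leq_trans; exact.
have [uv|/H] := ltnP (id u) (id v); last by rewrite leqNgt => /negPf.
apply: proper_card; apply/properP; split.
  by apply/subsetP => w; rewrite !inE => /ltn_trans; apply.
by exists u; rewrite !inE ?ltnn.
Qed.

Lemma rank_inj : injective rank.
Proof.
move=> u v uv; apply: id_inj.
by case: (ltngtP (id u) (id v)) => //; rewrite -ltn_rank uv ltnn.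
Qed.

(* The prover cannot adapt the ranking to the coins, which would cost a factor [n!] in
   the union bound: it is forced by the identifiers. *)
Lemma rank_unique (r : 'I_n -> 'I_n) : injective r ->
  (forall u v, r u = (r v).+1 :> nat -> (id v < id u)%N) -> r =1 rank.
Proof.
move=> r_inj step; have [r' rK r'K] := injF_bij r_inj.
have mono m u v : r u = (r v + m.+1)%N :> nat -> (id v < id u)%N.
  elim: m u => [|m IH] u ru; first by apply: step; rewrite ru addn1.
  have lt : (r v + m.+1 < n)%N by have := ltn_ord (r u); rewrite ru; lia.
  apply: ltn_trans (IH (r' (Ordinal lt)) _) (step _ _ _); rewrite r'K //= ru; lia.
have ltE u v : (id u < id v)%N = (r u < r v)%N.
  case: (ltngtP (r u) (r v)) => [uv|uv|/val_inj/r_inj ->]; last by rewrite ltnn.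
    by rewrite (mono (r v - r u).-1) //; lia.
  by apply/negbTE; rewrite -leqNgt ltnW // (mono (r u - r v).-1) //; lia.
move=> v; apply: val_inj; rewrite /=.
under eq_finset do rewrite ltE.
rewrite -(card_imset _ r_inj) -[LHS](card_ord (r v)).
rewrite -(card_imset _ (f := widen_ord (ltnW (ltn_ord (r v))))); last first.
  by move=> i j /(congr1 val) /= /val_inj.
apply: eq_card => i; apply/imsetP/imsetP => [[j _ ->]|[u + ->]].
  by exists (r' (widen_ord (ltnW (ltn_ord (r v))) j)); rewrite ?inE r'K //=.
by rewrite inE => uv; exists (Ordinal uv) => //; apply: val_inj.
Qed.

End Rank.

(** * Polynomials with coefficients spread over the nodes *)

Section PolyFamilies.
Variables (K : finFieldType) (k n : nat).

Lemma coef_sum_scaleXn (I : finType) (f : I -> nat) (g : I -> K) w :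
  injective f -> (\sum_v g v *: 'X^(f v))`_(f w) = g w.
Proof.
move=> f_inj; rewrite coef_sum (bigD1 w) //= coefZ coefXn eqxx mulr1.
rewrite big1 ?addr0 // => v vw.
by rewrite coefZ coefXn (inj_eq f_inj) eq_sym (negPf vw) mulr0.
Qed.

(* Valid in every characteristic: a label missed by [f] has coefficient 0 instead of 1,
   so [f] is onto, hence injective. *)
Lemma inj_of_sumXn (f : 'I_n -> 'I_n) :
  \sum_v 'X^(f v) = \sum_(i < n) 'X^i :> {poly K} -> injective f.
Proof.
move=> eqp.
have onto i : i \in codom f.
  apply/codomP; have /existsP[v /eqP <-] : [exists v, f v == i]; last by exists v.
  apply/existsPn => fi.
  have := coef_sum_scaleXn (fun=> 1) i (@ord_inj n).
  under eq_bigr do rewrite scale1r.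
  rewrite -eqp coef_sum big1 => [/eqP|v _]; first by rewrite eq_sym oner_eq0.
  by rewrite coefXn val_eqE eq_sym (negPf (fi v)).
apply/injectiveP/card_uniqP; rewrite size_codom card_ord -[RHS](card_ord n).
by apply: eq_card => i; rewrite onto.
Qed.

Lemma rVpoly_mxvec (F : 'M[K]_(k, n)) :
  rVpoly (mxvec F) = \sum_c \sum_i F c i *: 'X^(mxvec_index c i).
Proof.
rewrite [mxvec F]row_sum_delta linear_sum /=.
rewrite pair_bigA (reindex _ (curry_mxvec_bij k n)) /=.
by apply: eq_bigr => -[c i] _ /=; rewrite linearZ /= rVpoly_delta mxvecE.
Qed.

Lemma size_sum_le (I : finType) (F : I -> {poly K}) (N : nat) :
  (forall i, (size (F i) <= N)%N) -> (size (\sum_i F i)%R <= N)%N.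
Proof.
by move=> FN; rewrite (leq_trans (size_sum _ _ _)) //; apply/bigmax_leqP => i _.
Qed.

Lemma size_add_le (p p' : {poly K}) (N : nat) :
  (size p <= N)%N -> (size p' <= N)%N -> (size (p + p')%R <= N)%N.
Proof. by move=> pN p'N; rewrite (leq_trans (size_polyD _ _)) // geq_max pN. Qed.

Lemma size_scaleXn (c : K) (m N : nat) : (m < N)%N -> (size (c *: 'X^m) <= N)%N.
Proof. by move=> mN; rewrite (leq_trans (size_scale_leq _ _)) // size_polyXn. Qed.

Lemma size_XnM (p : {poly K}) (m N : nat) :
  (size p <= N)%N -> (size ('X^m * p)%R <= m + N)%N.
Proof.
move=> pN; rewrite (leq_trans (size_polyMleq _ _)) // size_polyXn addSn /=.
by rewrite leq_add2l.
Qed.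

(** The identity behind the honest successor check: what is announced at exponent [rank + 1] is what
    the next node holds at its own rank. *)
Lemma sum_shiftXn (N : nat) (G : nat -> K) :
  \sum_(i < N) (if (i.+1 < N)%N then G i.+1 else 0) *: 'X^(i.+1) =
  \sum_(i < N) (if (0 < i)%N then G i else 0) *: 'X^i.
Proof.
case: N => [|N]; first by rewrite !big_ord0.
rewrite big_ord_recr big_ord_recl /= ltnn !scale0r addr0 add0r.
by apply: eq_bigr => i _; rewrite ltnS ltn_ord.
Qed.

End PolyFamilies.

(** * The protocol and its local checks *)

Inductive check (k : nat) :=
  | RankBijective | RankSuccessor | KeyValue | SketchValue | ProductValue
  | LabelBijective of 'I_k | LabelCoin of 'I_k.

Section CheckFinite.
Variable k : nat.

Definition check_code (j : check k) : 'I_5 + ('I_k + 'I_k) :=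
  match j with
  | RankBijective => inl (inord 0) | RankSuccessor => inl (inord 1)
  | KeyValue => inl (inord 2) | SketchValue => inl (inord 3)
  | ProductValue => inl (inord 4)
  | LabelBijective c => inr (inl c) | LabelCoin c => inr (inr c)
  end.

Definition check_decode (x : 'I_5 + ('I_k + 'I_k)) : check k :=
  match x with
  | inl i => nth (RankBijective k) [:: RankBijective k; RankSuccessor k; KeyValue k;
                                       SketchValue k; ProductValue k] i
  | inr (inl c) => LabelBijective c
  | inr (inr c) => LabelCoin c
  end.

Lemma check_codeK : cancel check_code check_decode.
Proof. by case=> //=; rewrite inordK. Qed.

HB.instance Definition _ := Finite.copy (check k) (can_type check_codeK).

Lemma card_check : (#|{: check k}| <= 5 + (k + k))%N.
Proof.
have := leq_card _ (can_inj check_codeK).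
by rewrite !card_sum !card_ord.
Qed.

End CheckFinite.

Lemma connected_const (n : nat) (e : rel 'I_n) (A : Type) (F : 'I_n -> A) :
  connected_graph e -> (forall u v, e u v -> F v = F u) -> forall u v, F u = F v.
Proof.
move=> conn eF u v; have /connectP[s es ->] := conn u v.
by elim: s u es => //= w s IH u /andP[/eF <-]; apply: IH.
Qed.

Section Protocol.
Variables (K : finFieldType) (k n : nat) (pad : finType).
Variable (B : {ffun 'I_(k * n) -> {set K}}).
Local Notation q := #|K|.
Local Notation M := (k * n)%N.
Local Notation fam := {ffun 'I_k -> K}.
Local Notation labelling := {ffun 'I_k -> {perm 'I_n}}.
Local Notation seed := ({ffun 'I_k * 'I_n -> K} * (('rV[K]_M * 'rV[K]_M) * 'rV[K]_M))%type.

(** The point serves the second round; the families are sketch points, both halves of the hash key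
    and the shift. [pad] brings the number of coins to an exact power of 2. *)
Definition coin : finType := (K * (fam * fam * fam * fam) * pad)%type.
Definition coin_point (c : coin) : K := c.1.1.
Definition coin_alpha (c : coin) : fam := c.1.2.1.1.1.
Definition coin_lo (c : coin) : fam := c.1.2.1.1.2.
Definition coin_hi (c : coin) : fam := c.1.2.1.2.
Definition coin_shift (c : coin) : fam := c.1.2.2.

(** A node with label [i] in copy [a] needs [alpha(a, i)], a coin drawn by the node of rank [i], so
    the prover quotes it. The families lo, mid and hi are the three blocks of coefficients of the
    product. *)
Definition msg1 : finType :=
  ('I_q * 'I_q * 'I_q * 'I_n * 'I_n * {ffun 'I_k -> 'I_n} * (fam * fam * fam * fam))%type.
Definition msg_root (m : msg1) : 'I_q := m.1.1.1.1.1.1.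
Definition msg_parent (m : msg1) : 'I_q := m.1.1.1.1.1.2.
Definition msg_next (m : msg1) : 'I_q := m.1.1.1.1.2.
Definition msg_dist (m : msg1) : 'I_n := m.1.1.1.2.
Definition msg_rank (m : msg1) : 'I_n := m.1.1.2.
Definition msg_label (m : msg1) : {ffun 'I_k -> 'I_n} := m.1.2.
Definition msg_alpha (m : msg1) : fam := m.2.1.1.1.
Definition msg_lo (m : msg1) : fam := m.2.1.1.2.
Definition msg_mid (m : msg1) : fam := m.2.1.2.
Definition msg_hi (m : msg1) : fam := m.2.2.

Definition msg2 : finType := (K * K * K * {ffun check k -> K})%type.
Definition msg_values (m : msg2) : K * K * K := m.1.
Definition msg_sum (m : msg2) : {ffun check k -> K} := m.2.

(** An enumeration of the field, because the canonical map from the naturals is not injective on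
    identifiers in small characteristic. *)
Definition num (m : nat) : K := nth 0 (enum K) m.

Lemma num_inj m m' : (m < q)%N -> (m' < q)%N -> num m = num m' -> m = m'.
Proof.
move=> mq mq' /eqP; rewrite nth_uniq -?cardE ?enum_uniq //; exact: eqP.
Qed.

(** In [RankSuccessor] the node of rank [r] adds the identifier claimed for rank [r + 1] and removes
    its own at [r]; the guards leave out the exponents [n] and 0. *)
Definition node_poly (i : nat) (c : coin) (m : msg1) (nb : seq {ffun 'I_k -> 'I_n})
    (j : check k) : {poly K} :=
  match j with
  | RankBijective => 'X^(msg_rank m)
  | RankSuccessor =>
      (if ((msg_rank m).+1 < n)%N then num (msg_next m) else 0) *: 'X^((msg_rank m).+1)
      - (if (0 < msg_rank m)%N then num i else 0) *: 'X^(msg_rank m)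
  | KeyValue => \sum_a (coin_lo c a *: 'X^(mxvec_index a (msg_rank m))
                       + 'X^M * (coin_hi c a *: 'X^(mxvec_index a (msg_rank m))))
  | SketchValue => \sum_a (\sum_(l <- nb) 'X^(l a : 'I_n)).[msg_alpha m a]
                          *: 'X^(mxvec_index a (msg_label m a))
  | ProductValue => \sum_a (msg_lo m a *: 'X^(mxvec_index a (msg_rank m))
                       + 'X^M * (msg_mid m a *: 'X^(mxvec_index a (msg_rank m)))
                       + 'X^(M + M) * (msg_hi m a *: 'X^(mxvec_index a (msg_rank m))))
  | LabelBijective a => 'X^(msg_label m a)
  | LabelCoin a => msg_alpha m a *: 'X^(msg_label m a) - coin_alpha c a *: 'X^(msg_rank m)
  end.

Definition check_target (x : K * K * K) (j : check k) : K :=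
  match j with
  | RankBijective | LabelBijective _ => (\sum_(i < n) 'X^i).[x.1.1]
  | RankSuccessor | LabelCoin _ => 0
  | KeyValue => x.1.2
  | SketchValue => x.2
  | ProductValue => x.1.2 * x.2
  end.

(** The target is subtracted at distance 0 only, so a correct check is a vanishing sum over the
    tree. *)
Definition node_term (i : nat) (c : coin) (m : msg1) (x : K * K * K)
    (nb : seq {ffun 'I_k -> 'I_n}) (j : check k) : K :=
  (node_poly i c m nb j).[x.1.1] - (if msg_dist m == 0 :> nat then check_target x j else 0).

(** Agreement along edges makes the root and the evaluated values global, so only the root compares
    the point with its second coin. Each node adds its own shift before its box test. *)
Definition node_ok (i : nat) (c1 c2 : coin) (m1 : msg1) (m2 : msg2)
    (nb : seq (nat * msg1 * msg2)) : bool :=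
  [&& all (fun y => (msg_root y.1.2 == msg_root m1) && (msg_values y.2 == msg_values m2)) nb,
      (if msg_dist m1 == 0 :> nat
       then [&& i == msg_root m1 :> nat, (msg_values m2).1.1 == coin_point c2
             & [forall j, msg_sum m2 j == 0]]
       else has (fun y => (y.1.1 == msg_parent m1 :> nat) &&
                          (msg_dist m1 == (msg_dist y.1.2).+1 :> nat)) nb),
      [forall j, msg_sum m2 j ==
         node_term i c1 m1 (msg_values m2) [seq msg_label y.1.2 | y <- nb] j
         + \sum_(y <- nb | (msg_parent y.1.2 == i :> nat) &&
                           (msg_dist y.1.2 == (msg_dist m1).+1 :> nat)) msg_sum y.2 j],
      ((msg_rank m1).+1 < n)%N ==> (i < msg_next m1)%N
    & [forall a, msg_mid m1 a + coin_shift c1 a \in B (mxvec_index a (msg_rank m1))]].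

Variables (e : rel 'I_n) (id : 'I_n -> nat) (port : 'I_n -> seq 'I_n).
Hypotheses (e_sym : forall u v, e u v = e v u) (conn : connected_graph e).
Hypotheses (id_inj : injective id) (id_bound : forall v, (id v < q)%N).
Hypotheses (portP : port_numbering e port) (n0 : (0 < n)%N) (k0 : (0 < k)%N).

Local Notation coins := {ffun 'I_n -> coin}.

Definition neighbours (m1 : 'I_n -> msg1) (m2 : 'I_n -> msg2) v :=
  [seq (id u, m1 u, m2 u) | u <- port v].

Definition all_ok (r1 r2 : coins) (m1 : 'I_n -> msg1) (m2 : 'I_n -> msg2) : bool :=
  [forall v, node_ok (id v) (r1 v) (r2 v) (m1 v) (m2 v) (neighbours m1 m2 v)].

Definition total_poly (r1 : coins) (m1 : 'I_n -> msg1) (j : check k) : {poly K} :=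
  \sum_v node_poly (id v) (r1 v) (m1 v) [seq msg_label (m1 u) | u <- port v] j.

(** [KeyValue] and [SketchValue] have no identity of their own: they force the two factor values
    that [ProductValue] multiplies. *)
Definition defect (r1 : coins) (m1 : 'I_n -> msg1) (j : check k) : {poly K} :=
  match j with
  | RankBijective | LabelBijective _ => total_poly r1 m1 j - \sum_(i < n) 'X^i
  | RankSuccessor | LabelCoin _ => total_poly r1 m1 j
  | KeyValue | SketchValue => 0
  | ProductValue => total_poly r1 m1 j
                    - total_poly r1 m1 (KeyValue k) * total_poly r1 m1 (SketchValue k)
  end.

Lemma big_port (V : nmodType) (v : 'I_n) (P : pred 'I_n) (F : 'I_n -> V) :
  \sum_(u <- port v | P u) F u = \sum_(u | e v u && P u) F u.
Proof.
have [uniq_port memE] := portP v.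
rewrite big_mkcond -(big_mkcond P).
rewrite (perm_big (enum [pred u | e v u])).
  by rewrite big_enum_cond.
apply: uniq_perm; rewrite ?enum_uniq // => u.
by rewrite mem_enum memE.
Qed.

Lemma labels_neighbours m1 m2 v :
  [seq msg_label y.1.2 | y <- neighbours m1 m2 v] = [seq msg_label (m1 u) | u <- port v].
Proof. by rewrite -map_comp. Qed.

(** * Consequences of acceptance *)

Section Sound.
Variables (r1 r2 : coins) (m1 : 'I_n -> msg1) (m2 : 'I_n -> msg2).
Hypothesis ok : all_ok r1 r2 m1 m2.
Local Notation dist v := (msg_dist (m1 v)).

Lemma ok_node v : node_ok (id v) (r1 v) (r2 v) (m1 v) (m2 v) (neighbours m1 m2 v).
Proof. by move/forallP: ok. Qed.

Lemma ok_parent v : dist v != 0%N :> nat ->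
  exists2 u, e v u & (id u == msg_parent (m1 v) :> nat) && (dist v == (dist u).+1 :> nat).
Proof.
move=> dv; have /and5P[_ + _ _ _] := ok_node v.
rewrite (negPf dv) has_map => /hasP[u + /= h]; exists u => //.
by have [_ <-] := portP v.
Qed.

(** Claimed distances drop by one along claimed parents, so the descent ends at 0. *)
Lemma ok_root : exists v, dist v = 0%N :> nat.
Proof.
suff H m v : dist v = m :> nat -> exists v, dist v = 0%N :> nat.
  exact: (H _ (Ordinal n0)).
elim: m v => [|m IH] v dv; first by exists v.
have [|u _ /andP[_ /eqP du]] := @ok_parent v; first by rewrite dv.
by apply: (IH u); rewrite dv in du; case: du.
Qed.

Lemma ok_const u v : (msg_root (m1 u) = msg_root (m1 v)) *
                     (msg_values (m2 u) = msg_values (m2 v)).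
Proof.
have H : forall u v, (msg_root (m1 u), msg_values (m2 u)) = (msg_root (m1 v), msg_values (m2 v)).
  apply: (connected_const (e := e)) => // {}u {}v euv.
  have /and5P[+ _ _ _ _] := ok_node u; rewrite all_map => /allP/(_ v).
  by have [_ ->] := portP u; move=> /(_ euv)/andP[/eqP /= -> /eqP ->].
by have [-> ->] := H u v.
Qed.

(** Nodes at distance 0 carry the globally agreed root identifier, and identifiers are injective. *)
Lemma ok_root_unique u v : dist u = 0%N :> nat -> dist v = 0%N :> nat -> u = v.
Proof.
move=> du dv; apply: id_inj.
have /and5P[_ + _ _ _] := ok_node u; rewrite du eqxx => /and3P[/eqP -> _ _].
have /and5P[_ + _ _ _] := ok_node v; rewrite dv eqxx => /and3P[/eqP -> _ _].
by rewrite (ok_const u v).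
Qed.

Lemma ok_total root : dist root = 0%N :> nat -> forall j,
  (total_poly r1 m1 j).[(msg_values (m2 root)).1.1] = check_target (msg_values (m2 root)) j.
Proof.
move=> droot j; set x := msg_values (m2 root).
pose f v := node_term (id v) (r1 v) (m1 v) x [seq msg_label (m1 u) | u <- port v] j.
have : \sum_v f v = 0.
  apply: (@tree_sum0 _ n e id e_sym id_inj (fun v => msg_parent (m1 v))
     (fun v => dist v) _ (fun v => msg_sum (m2 v) j)).
  - by move=> v dv; apply: ok_parent.
  - move=> v; have /and5P[_ _ /forallP/(_ j)/eqP -> _ _] := ok_node v.
    rewrite labels_neighbours (ok_const v root) big_map; congr (_ + _).
    by rewrite (big_port v (fun u => (msg_parent (m1 u) == id v :> nat) && _)).
  - move=> v dv; have /and5P[_ + _ _ _] := ok_node v.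
    by rewrite dv eqxx => /and3P[_ _ /forallP/(_ j)/eqP].
rewrite sumrB -horner_sum => /eqP; rewrite subr_eq0 => /eqP ->.
rewrite -big_mkcond (big_pred1 root) // => v /=.
apply/eqP/eqP => [dv|-> //]; exact: ok_root_unique.
Qed.

Lemma ok_defect v : dist v = 0%N :> nat -> forall j,
  root (defect r1 m1 j) (coin_point (r2 v)).
Proof.
move=> dv j; have tot := ok_total dv.
have : (msg_values (m2 v)).1.1 = coin_point (r2 v).
  have /and5P[_ + _ _ _] := ok_node v.
  by rewrite dv eqxx => /and3P[_ /eqP].
rewrite /root => <-; case: j => [||||| a | a] /=; rewrite ?hornerE ?hornerN ?hornerM ?tot //=.
all: by rewrite subrr.
Qed.

End Sound.

(** * From polynomial identities to a hit *)

Definition rank_perm : {perm 'I_n} := perm (rank_inj id_inj).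

Definition by_rank (F : 'I_n -> fam) : 'rV[K]_M :=
  mxvec (\matrix_(a, i) F ((rank_perm^-1)%g i) a).

(** Indexing by the true rank makes the seed a function of the first coins alone, beyond the
    prover's control. *)
Definition seed_of (r1 : coins) : seed :=
  ([ffun m => coin_alpha (r1 ((rank_perm^-1)%g m.2)) m.1],
   ((by_rank (fun v => coin_lo (r1 v)), by_rank (fun v => coin_hi (r1 v))),
    by_rank (fun v => coin_shift (r1 v)))).

Lemma sum_perm_rVpoly (F : 'I_n -> 'I_k -> K) (s : 'I_k -> {perm 'I_n}) :
  \sum_v \sum_a F v a *: 'X^(mxvec_index a (s a v)) =
  rVpoly (mxvec (\matrix_(a, i) F ((s a)^-1 i)%g a)).
Proof.
rewrite rVpoly_mxvec exchange_big /=; apply: eq_bigr => a _.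
rewrite [RHS](reindex_inj (@perm_inj _ (s a))) /=.
by apply: eq_bigr => v _; rewrite mxE permK.
Qed.

Lemma sum_rank_rVpoly (F : 'I_n -> fam) (r : 'I_n -> 'I_n) : r =1 rank id ->
  \sum_v \sum_a F v a *: 'X^(mxvec_index a (r v)) = rVpoly (by_rank F).
Proof.
move=> rE; rewrite -(sum_perm_rVpoly (fun v a => F v a) (fun=> rank_perm)).
by under eq_bigr do under eq_bigr do rewrite rE -(permE (rank_inj id_inj)).
Qed.

Lemma middle3 (x y z : 'rV[K]_M) :
  middle M (rVpoly x + 'X^M * rVpoly y + 'X^(M + M) * rVpoly z) = y.
Proof.
apply/rowP => m; rewrite mxE exprD -mulrA -addrA -mulrDr.
rewrite coefD coef_rVpoly coefXnM ltnNge leq_addr /= addKn coefD coef_rVpoly_ord.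
rewrite coefXnM ltn_ord addr0; case: insubP => [i + _|_]; last by rewrite add0r.
by rewrite ltnNge leq_addr.
Qed.

Section Good.
Variables (r1 : coins) (m1 : 'I_n -> msg1).
Local Notation rk v := (msg_rank (m1 v)).

Lemma total_key : (fun v => rk v) =1 rank id ->
  total_poly r1 m1 (KeyValue k) = split_poly (seed_of r1).2.1.
Proof.
move=> rkE; rewrite /split_poly /= -!(sum_rank_rVpoly _ rkE) mulr_sumr -big_split /=.
by apply: eq_bigr => v _; rewrite mulr_sumr -big_split.
Qed.

Lemma total_product : (fun v => rk v) =1 rank id ->
  total_poly r1 m1 (ProductValue k) =
    rVpoly (by_rank (fun v => msg_lo (m1 v)))
    + 'X^M * rVpoly (by_rank (fun v => msg_mid (m1 v)))
    + 'X^(M + M) * rVpoly (by_rank (fun v => msg_hi (m1 v))).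
Proof.
move=> rkE; rewrite -!(sum_rank_rVpoly _ rkE) !mulr_sumr -!big_split /=.
by apply: eq_bigr => v _; rewrite !mulr_sumr -!big_split.
Qed.

Lemma total_sketch (tau : labelling) :
  (forall v a, msg_label (m1 v) a = ((tau a)^-1)%g v) ->
  (forall v a, msg_alpha (m1 v) a = (seed_of r1).1 (a, msg_label (m1 v) a)) ->
  total_poly r1 m1 (SketchValue k) = rVpoly (sketch e (seed_of r1).1 tau).
Proof.
move=> labE alE; rewrite /total_poly /=.
under eq_bigr do under eq_bigr do rewrite labE.
rewrite (sum_perm_rVpoly (fun v a => (\sum_(l <- [seq msg_label (m1 u) | u <- port v])
   'X^(l a : 'I_n)).[msg_alpha (m1 v) a]) (fun a => (tau a)^-1)%g).
congr (rVpoly (mxvec _)); apply/matrixP => a i; rewrite !mxE invgK alE labE permK.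
congr horner; rewrite big_map big_port /row_poly /=.
rewrite (reindex_inj (@perm_inj _ (tau a))) /=.
by apply: eq_big => [j|j _]; rewrite ?andbT // labE permK.
Qed.

Lemma good_hit :
  (forall j, defect r1 m1 j = 0) ->
  (forall v, ((rk v).+1 < n)%N -> (id v < msg_next (m1 v))%N) ->
  (forall v a, msg_mid (m1 v) a + coin_shift (r1 v) a \in B (mxvec_index a (rk v))) ->
  [exists tau, hit e B (seed_of r1) tau].
Proof.
move=> good nextP midP.
have rk_inj : injective (fun v => rk v).
  by apply: (@inj_of_sumXn K); apply/eqP; rewrite -subr_eq0; apply/eqP/(good (RankBijective k)).
have rkE : (fun v => rk v) =1 rank id.
  apply: rank_unique => // u v ruv.
  have lt : ((rk v).+1 < n)%N by rewrite -ruv ltn_ord.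
  (* At exponent [rk u = rk v + 1] the identifier announced by [v] must be that of [u], as [num] is
     injective below [q]. *)
  have := good (RankSuccessor k); rewrite /= /total_poly /= sumrB => /eqP.
  rewrite subr_eq0 => /eqP/polyP/(_ (rk u)).
  rewrite (coef_sum_scaleXn (f := fun v => rk v : nat) _ u); last by move=> x y /val_inj/rk_inj.
  rewrite {1}ruv (coef_sum_scaleXn (f := fun v => (rk v).+1) _ v); last first.
    by move=> x y [] /val_inj/rk_inj.
  by rewrite lt ruv /= => /num_inj <- //; apply: nextP.
have lab_inj a : injective (fun v => msg_label (m1 v) a).
  by apply: (@inj_of_sumXn K); apply/eqP; rewrite -subr_eq0; apply/eqP/(good (LabelBijective a)).
(* Messages map vertices to labels, whereas [tau] maps labels to vertices. *)
pose tau : labelling := [ffun a => (perm (lab_inj a))^-1%g].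
have labE v a : msg_label (m1 v) a = ((tau a)^-1)%g v by rewrite ffunE invgK permE.
have alE v a : msg_alpha (m1 v) a = (seed_of r1).1 (a, msg_label (m1 v) a).
  have := good (LabelCoin a); rewrite /= /total_poly /= sumrB => /eqP.
  rewrite subr_eq0 => /eqP/polyP/(_ (msg_label (m1 v) a)).
  rewrite (coef_sum_scaleXn (f := fun v => msg_label (m1 v) a : nat) _ v); last first.
    by move=> x y /val_inj/lab_inj.
  (* [w] is the node whose rank equals the label, hence the owner of the quoted coin. *)
  move=> ->; rewrite ffunE /=; set w := fun_of_perm (rank_perm^-1)%g _.
  have -> : msg_label (m1 v) a = rk w by rewrite rkE -(permE (rank_inj id_inj)) permKV.
  by rewrite (coef_sum_scaleXn (f := fun v => rk v : nat)) // => x y /val_inj/rk_inj.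
apply/existsP; exists tau; rewrite /hit /hash inE -total_key // -total_sketch //.
have /eqP := good (ProductValue k); rewrite /= subr_eq0 => /eqP <-.
rewrite total_product // middle3; apply/forallP => m.
case/mxvec_indexP: m => a i; rewrite mxE !mxvecE !mxE.
by have := midP ((rank_perm^-1)%g i) a; rewrite rkE -(permE (rank_inj id_inj)) permKV.
Qed.

End Good.

(** * The honest prover *)

Lemma poly_split3 (p : {poly K}) : (size p <= M + M + M)%N ->
  p = rVpoly (\row_(m < M) p`_m) + 'X^M * rVpoly (\row_(m < M) p`_(M + m))
      + 'X^(M + M) * rVpoly (\row_(m < M) p`_(M + M + m)).
Proof.
move=> sp; apply/polyP => i; rewrite !coefD !coefXnM !coef_rVpoly.
have [iM|Mi] := ltnP i M.
  by rewrite insubT /= (leq_trans iM) ?leq_addr // mxE !addr0.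
rewrite insubF; last by apply/negbTE; rewrite -leqNgt.
have [iM|MMi] := ltnP i (M + M).
  have lt : (i - M < M)%N by lia.
  by rewrite insubT /= mxE /= subnKC // add0r addr0.
rewrite insubF; last by apply/negbTE; rewrite -leqNgt; lia.
have [iM|MMMi] := ltnP (i - (M + M)) M.
  by rewrite insubT mxE /= subnKC // !add0r.
rewrite insubF; last by apply/negbTE; rewrite -leqNgt.
by rewrite nth_default ?add0r // (leq_trans sp) //; lia.
Qed.

Lemma by_rank_row (G : nat -> K) :
  by_rank (fun v => [ffun a => G (mxvec_index a (rank id v))]) = \row_(m < M) G m.
Proof.
apply/rowP => m; case/mxvec_indexP: m => a i; rewrite mxvecE !mxE ffunE.
by rewrite -(permE (rank_inj id_inj)) permKV.
Qed.

Lemma size_split_poly (a : 'rV[K]_M * 'rV[K]_M) : (size (split_poly a) <= M + M)%N.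
Proof.
rewrite (leq_trans (size_polyD _ _)) // geq_max.
rewrite (leq_trans (size_poly _ _)) ?leq_addr //= (leq_trans (size_polyMleq _ _)) //.
by rewrite size_polyXn addSn /= leq_add2l size_poly.
Qed.

(** The first message is fixed before [r2]; the second evaluates the totals at the root's point and
    sums them along a breadth-first tree. *)
Lemma honest_prover (r1 : coins) (tau : labelling) : hit e B (seed_of r1) tau ->
  exists m1, forall r2, exists m2, all_ok r1 r2 m1 m2.
Proof.
move=> hitP; pose root : 'I_n := Ordinal n0.
have [d [p [d0 dP]]] := bfs_tree root e_sym conn.
pose idq v : 'I_q := Ordinal (id_bound v).
pose node i : 'I_n := (rank_perm^-1)%g i.
have nodeK i : rank id (node i) = i by rewrite -(permE (rank_inj id_inj)) permKV.
have rankK v : node (rank id v) = v.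
  by rewrite /node -(permE (rank_inj id_inj)) -/rank_perm permK.
(* At the last rank, where no successor exists, [next] defaults to the node's own identifier. *)
pose next v : 'I_q := if insub (rank id v).+1 is Some i then idq (node i) else idq v.
pose key := split_poly (seed_of r1).2.1 * rVpoly (sketch e (seed_of r1).1 tau).
pose lab v : {ffun 'I_k -> 'I_n} := [ffun a => ((tau a)^-1)%g v].
pose coefs (m : nat) v : fam := [ffun a => key`_(m + mxvec_index a (rank id v))].
pose m1 v : msg1 := (idq root, idq (p v), next v, d v, rank id v, lab v,
  ([ffun a => (seed_of r1).1 (a, lab v a)], coefs 0 v, coefs M v, coefs (M + M) v)).
have rkE : (fun v => msg_rank (m1 v)) =1 rank id by [].
have labE v a : msg_label (m1 v) a = ((tau a)^-1)%g v by rewrite ffunE.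
have alE v a : msg_alpha (m1 v) a = (seed_of r1).1 (a, msg_label (m1 v) a) by rewrite ffunE.
have prodE : total_poly r1 m1 (ProductValue k) = key.
  rewrite total_product //.
  rewrite (by_rank_row (fun m => key`_m)) (by_rank_row (fun m => key`_(M + m))).
  rewrite (by_rank_row (fun m => key`_(M + M + m))) -poly_split3 //.
  rewrite (leq_trans (size_polyMleq _ _)) // (leq_trans (leq_pred _)) // leq_add //.
    exact: size_split_poly.
  exact: size_poly.
have coinE a : \sum_v coin_alpha (r1 v) a *: 'X^(rank id v) =
    \sum_(i < n) (seed_of r1).1 (a, i) *: 'X^i.
  rewrite [RHS](reindex_inj (rank_inj id_inj)) /=; apply: eq_bigr => v _.
  by rewrite ffunE /= -/(node _) rankK.
exists m1 => r2; pose x := coin_point (r2 root).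
pose vals := (x, (total_poly r1 m1 (KeyValue k)).[x], (total_poly r1 m1 (SketchValue k)).[x]).
have totE j : (total_poly r1 m1 j).[x] = check_target vals j.
  case: j => //= [||| a | a].
  - by rewrite /total_poly [in RHS](reindex_inj (rank_inj id_inj)).
  - rewrite -[RHS](horner0 x) /total_poly /= sumrB; congr horner; apply/eqP; rewrite subr_eq0.
    (* [G m] is the field code of the identifier of rank [m], so both parts become sums over ranks
       related by [sum_shiftXn]. *)
    pose G m := if insub m is Some i then num (id (node i)) else 0.
    have Grank v : G (rank id v) = num (id v) by rewrite /G valK rankK.
    apply/eqP; transitivity (\sum_(i < n) (if (i.+1 < n)%N then G i.+1 else 0) *: 'X^(i.+1)).
      rewrite [RHS](reindex_inj (rank_inj id_inj)) /=; apply: eq_bigr => v _.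
      rewrite /msg_next /= /next /G; case: ifP => // lt.
      by rewrite insubT.
    rewrite sum_shiftXn [LHS](reindex_inj (rank_inj id_inj)) /=; apply: eq_bigr => v _.
    by case: ifP => // _; congr (_ *: _); rewrite -[RHS]Grank.
  - by rewrite prodE /key hornerM total_key // (total_sketch labE).
  - rewrite /total_poly /=; congr horner.
    rewrite [in RHS](reindex_inj (@perm_inj _ (tau a)^-1%g)) /=.
    by apply: eq_bigr => v _; rewrite labE.
  - rewrite -[RHS](horner0 x) /total_poly /= sumrB coinE; congr horner.
    rewrite [X in _ - X](reindex_inj (@perm_inj _ (tau a)^-1%g)) /=.
    by rewrite -sumrB big1 // => v _; rewrite alE labE subrr.
pose f j v := node_term (id v) (r1 v) (m1 v) vals [seq msg_label (m1 u) | u <- port v] j.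
have dE v : (d v == 0%N :> nat) = (v == root).
  by apply/eqP/eqP => [dv|-> //]; apply/eqP/negPn/negP => /dP[_]; rewrite dv.
have f0 j : \sum_v f j v = 0.
  rewrite sumrB -horner_sum -/(total_poly r1 m1 j) totE -big_mkcond.
  by rewrite (big_pred1 root) ?subrr // => v; rewrite /= dE.
pose par v : nat := id (p v).
have parP v : (d v : nat) != 0%N ->
    exists2 u, e v u & (id u == par v) && ((d v : nat) == (d u).+1).
  by rewrite dE => /dP[ev dv]; exists (p v); rewrite // eqxx dv /=.
pose S j := subtree_sum e id par (fun v => d v : nat) (f j).
exists (fun v => (vals, [ffun j => S j v])); apply/forallP => v.
have [port_uniq portE] := portP v.
apply/and5P; split.
- by apply/allP => _ /mapP[u _ ->]; rewrite /= !eqxx.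
- rewrite /msg_dist /= dE; case: eqP => [->|/eqP/dP[ev dv]].
    rewrite !eqxx /=; apply/forallP => j; rewrite ffunE; apply/eqP.
    by apply: (subtree_sum_root e_sym id_inj parP).
  apply/hasP; exists (id (p v), m1 (p v), (vals, [ffun j => S j (p v)])).
    by apply/mapP; exists (p v); rewrite ?portE.
  by rewrite /= eqxx dv /=.
- apply/forallP => j; rewrite ffunE /S subtree_sumE //; apply/eqP; congr (_ + _).
    by rewrite labels_neighbours.
  rewrite big_map big_port; apply: eq_big => [u|u _]; last by rewrite ffunE.
  by [].
- apply/implyP => lt; rewrite /msg_next /= /next insubT /=.
  by rewrite -ltn_rank nodeK.
- apply/forallP => a; move: hitP; rewrite /hit inE => /forallP/(_ (mxvec_index a (rank id v))).
  by rewrite !mxE mxvecE mxE -/(node _) rankK ffunE.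
Qed.

(** * Acceptance probabilities *)

Lemma size_defect r1 m1 j : (size (defect r1 m1 j) <= M + M + M)%N.
Proof.
have nM : (n <= M)%N by rewrite -[leqLHS]mul1n leq_mul2r k0 orbT.
have sXn (i : 'I_n) : (size ('X^i : {poly K}) <= M + M + M)%N.
  by rewrite size_polyXn; have := ltn_ord i; lia.
have idx (a : 'I_k) (i : 'I_n) : (mxvec_index a i < M)%N by rewrite ltn_ord.
have sall : (size (\sum_(i < n) 'X^i : {poly K})%R <= M + M + M)%N by apply: size_sum_le.
case: j => [||||| a | a] /=; rewrite ?size_poly0 //.
- by rewrite size_add_le ?size_polyN //; apply: size_sum_le => v; apply: sXn.
- apply: size_sum_le => v; rewrite size_add_le ?size_polyN // size_scaleXn //;
    have := ltn_ord (msg_rank (m1 v)); lia.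
- rewrite size_add_le ?size_polyN //.
    apply: size_sum_le => v; apply: size_sum_le => a.
    rewrite !size_add_le //.
    + by apply: size_scaleXn; have := idx a (msg_rank (m1 v)); lia.
    + by rewrite (leq_trans (size_XnM _ (size_scaleXn _ (idx _ _)))) // leq_addr.
    + by rewrite (leq_trans (size_XnM _ (size_scaleXn _ (idx _ _)))).
  (* The extremal case: a key of size at most [2M] times a sketch of size at most [M]. *)
  rewrite (leq_trans (size_polyMleq _ _)) // (leq_trans (leq_pred _)) // leq_add //.
    apply: size_sum_le => v; apply: size_sum_le => a; apply: size_add_le.
      by apply: size_scaleXn; have := idx a (msg_rank (m1 v)); lia.
    by rewrite size_XnM // size_scaleXn.
  by apply: size_sum_le => v; apply: size_sum_le => a; apply: size_scaleXn.
- by rewrite size_add_le ?size_polyN //; apply: size_sum_le => v; apply: sXn.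
- apply: size_sum_le => v; rewrite size_add_le ?size_polyN // size_scaleXn //.
    by have := ltn_ord (msg_label (m1 v) a); lia.
  by have := ltn_ord (msg_rank (m1 v)); lia.
Qed.

Lemma card_coins : #|{: coins}| = (#|coin| ^ n)%N.
Proof. by rewrite card_ffun card_ord. Qed.

(** Only the point drawn by [v] is constrained, and it must be one of fewer than [N] roots. *)
Lemma card_coins_root (p : {poly K}) (v : 'I_n) (N : nat) :
  p != 0 -> (size p <= N)%N ->
  (q * #|[set r : coins | root p (coin_point (r v))]| <= N * #|{: coins}|)%N.
Proof.
move=> p0 pN; pose P (i : 'I_n) : pred coin :=
  fun c => (i == v) ==> root p (coin_point c).
have -> : #|[set r : coins | root p (coin_point (r v))]| =
          #|[set r : coins | [forall i, P i (r i)]]|.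
  apply: eq_card => r; rewrite !inE; apply/idP/forallP => [h i|/(_ v)].
    by apply/implyP => /eqP ->.
  by rewrite /P eqxx.
rewrite card_ffun_forall (bigD1 v) //=.
have -> : (\prod_(i | i != v) #|P i| = #|coin| ^ n.-1)%N.
  rewrite -[X in (_ ^ X.-1)%N](card_ord n) (cardD1 v) /= -prod_nat_const.
  rewrite (eq_bigl (mem [predD1 'I_n & v])) => [|i]; last by rewrite !inE andbT.
  apply: eq_bigr => i; rewrite !inE andbT => /negPf iv; apply: eq_card => c.
  by rewrite unfold_in /P iv.
have -> : #|{: coins}| = (#|coin| * #|coin| ^ n.-1)%N.
  by rewrite card_coins -expnS prednK.
rewrite !mulnA leq_mul2r; apply/orP; right.
pose rts := [set x | root p x].
have -> : #|P v| = (#|rts| * #|{: fam * fam * fam * fam}| * #|pad|)%N.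
  have -> : (#|rts| * #|{: fam * fam * fam * fam}| * #|pad| =
             #|setX (setX rts [set: fam * fam * fam * fam]) [set: pad]|)%N.
    by rewrite !cardsX !cardsT.
  by apply: eq_card => -[[x y] z]; rewrite unfold_in /P eqxx /= !inE !andbT.
have -> : #|coin| = (q * #|{: fam * fam * fam * fam}| * #|pad|)%N by rewrite !card_prod.
have : (#|rts| <= N)%N.
  rewrite cardE; apply: leq_trans (ltnW (max_poly_roots p0 _ (enum_uniq _))) pN.
  by apply/allP => x; rewrite mem_enum inE.
move: #|{: fam * fam * fam * fam}| => f rN.
rewrite (_ : q * (#|rts| * f * #|pad|) = #|rts| * (q * f * #|pad|))%N; last by ring.
by rewrite leq_mul2r rN orbT.
Qed.

Lemma by_rank_inj (F F' : 'I_n -> fam) : by_rank F = by_rank F' -> F =1 F'.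
Proof.
move/(can_inj mxvecK)/matrixP => h v; apply/ffunP => a.
by have := h a (rank_perm v); rewrite !mxE permK.
Qed.

(** The seed of uniform coins is uniform: together with the points and the padding it determines the
    coins bijectively. *)
Lemma card_seed_of (Q : pred _) :
  (#|[set r : coins | Q (seed_of r)]| *
     #|{: seed}|
   = #|[set w | Q w]| * #|{: coins}|)%N.
Proof.
pose rest : finType := {ffun 'I_n -> K * pad}.
pose g (r : coins) : seed * rest := (seed_of r, [ffun v => ((r v).1.1, (r v).2)]).
have g_inj : injective g.
  move=> r r' [] /ffunP h1 /by_rank_inj h2 /by_rank_inj h3 /by_rank_inj h4 /ffunP h5.
  apply/ffunP => v; have := h5 v; have := h2 v; have := h3 v; have := h4 v.
  have : coin_alpha (r v) = coin_alpha (r' v).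
    apply/ffunP => a; have := h1 (a, rank_perm v).
    by rewrite !ffunE /= permK.
  rewrite !ffunE; case: (r v) => [[x [[[? ?] ?] ?]] y].
  case: (r' v) => [[x' [[[? ?] ?] ?]] y'].
  by rewrite /coin_alpha /coin_lo /coin_hi /coin_shift /= => -> -> -> -> [-> ->].
have cardE : #|{: coins}| = (#|{: seed}| * #|rest|)%N.
  rewrite card_coins card_seed !card_ffun !card_prod !card_ffun !card_ord.
  by rewrite !expnMn -!expnM expnD; ring.
have g_bij : bijective g by apply: inj_card_bij; rewrite // card_prod cardE.
have -> : #|[set r | Q (seed_of r)]| = (#|[set w | Q w]| * #|rest|)%N.
  rewrite -cardsT -cardsX -(on_card_preimset (f := g) (R := setX [set w | Q w] setT)).
    by apply: eq_card => r; rewrite !inE andbT.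
  exact: onW_bij.
by rewrite cardE; ring.
Qed.

Hypotheses (pad0 : (0 < #|pad|)%N)
  (box_card : (8 * q ^ M <= #|box B| * n`! ^ k <= 16 * q ^ M)%N).

Local Notation accepted Q1 Q2 := [set rr : coins * coins |
  all_ok rr.1 rr.2 (Q1 rr.1) (Q2 rr.1 rr.2)].

Lemma coins_gt0 : (0 < #|{: coins}|)%N.
Proof.
rewrite card_coins expn_gt0 !card_prod !card_ffun !muln_gt0 !expn_gt0 pad0.
by have -> : (0 < q)%N by apply/card_gt0P; exists 0.
Qed.

Lemma seed_gt0 :
  (0 < #|{: seed}|)%N.
Proof.
rewrite card_seed !muln_gt0 !expn_gt0.
by have -> : (0 < q)%N by apply/card_gt0P; exists 0.
Qed.

Lemma card_not_hit (h : (2 * (M * n ^ 2) <= q)%N) : Asym e ->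
  (4 * #|[set r1 | ~~ [exists tau, hit e B (seed_of r1) tau]]| <= #|{: coins}|)%N.
Proof.
move=> asym; rewrite -(leq_pmul2r seed_gt0) -mulnA.
rewrite (card_seed_of (fun w => ~~ [exists tau, hit e B w tau])).
rewrite mulnA [leqRHS]mulnC leq_mul2r; apply/orP; right.
exact: most_seeds_hit.
Qed.

Lemma card_hit_coins : (64 <= 2 ^ k)%N -> ~ Asym e ->
  (4 * #|[set r1 | [exists tau, hit e B (seed_of r1) tau]]| <= #|{: coins}|)%N.
Proof.
move=> k64 nasym; rewrite -(leq_pmul2r seed_gt0) -mulnA.
rewrite (card_seed_of (fun w => [exists tau, hit e B w tau])).
rewrite mulnA [leqRHS]mulnC leq_mul2r; apply/orP; right.
exact: few_seeds_hit.
Qed.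

(** At least 3/4 of the first coins have a hit, and on those the honest prover succeeds for all
    second coins. *)
Lemma protocol_complete : (2 * (M * n ^ 2) <= q)%N -> Asym e ->
  exists Q1 Q2, (2 * (#|{: coins}| * #|{: coins}|) < 3 * #|accepted Q1 Q2|)%N.
Proof.
move=> h asym; set H := [set r1 | [exists tau, hit e B (seed_of r1) tau]].
have q0 : (0 < q)%N by apply/card_gt0P; exists 0.
pose o : 'I_n := Ordinal n0; pose oq : 'I_q := Ordinal q0.
pose x1 : msg1 := (oq, oq, oq, o, o, [ffun=> o], ([ffun=> 0], [ffun=> 0], [ffun=> 0], [ffun=> 0])).
pose x2 : msg2 := (0, 0, 0, [ffun=> 0]).
have h1 (r1 : coins) : exists m1, r1 \in H -> forall r2, exists m2, all_ok r1 r2 m1 m2.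
  have [|_] := boolP (r1 \in H); last by exists (fun=> x1).
  by rewrite inE => /existsP[tau /honest_prover[m1 hm]]; exists m1.
have [Q1 Q1P] := fin_all_exists h1.
have h2 (rr : coins * coins) : exists m2, rr.1 \in H -> all_ok rr.1 rr.2 (Q1 rr.1) m2.
  have [/Q1P/(_ rr.2)[m2 ok]|_] := boolP (rr.1 \in H); first by exists m2.
  by exists (fun=> x2).
have [Q2 Q2P] := fin_all_exists h2.
pose Q2' r1 r2 := Q2 (r1, r2); exists Q1, Q2'.
have sub : setX H [set: coins] \subset accepted Q1 Q2'.
  by apply/subsetP => -[r1 r2]; rewrite !inE andbT => r1H; apply: (Q2P (r1, r2)); rewrite inE.
have := subset_leq_card sub; rewrite cardsX cardsT.
have : (#|H| + #|[set r1 | ~~ [exists tau, hit e B (seed_of r1) tau]]| = #|{: coins}|)%N.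
  rewrite -(cardsC H); congr (_ + _)%N; apply: eq_card => r; by rewrite !inE.
have := card_not_hit h asym; have := coins_gt0.
set Y := #|[set r1 | ~~ _]|.
move: #|accepted Q1 Q2'| Y #|H| #|{: coins}| => X Y h' N; nia.
Qed.

(** Without a hit some defect is nonzero. It and the root node are fixed before [r2], so acceptance
    forces the fresh point to be a root, with probability at most [3M / q <= 1/16]. *)
Lemma ok_few (r1 : coins) (m1 : 'I_n -> msg1) (Q2 : coins -> 'I_n -> msg2) :
  ~~ [exists tau, hit e B (seed_of r1) tau] -> (16 * (M + M + M) <= q)%N ->
  (16 * #|[set r2 | all_ok r1 r2 m1 (Q2 r2)]| <= #|{: coins}|)%N.
Proof.
move=> nohit Mq.
(* One accepted [r0] supplies the root and the local conditions on [m1]; if there is none, the bound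
   is trivial. *)
have [->|[r0]] := set_0Vmem [set r2 | all_ok r1 r2 m1 (Q2 r2)].
  by rewrite cards0 muln0.
rewrite inE => ok0; have [v dv] := ok_root ok0.
have [j dj] : exists j, defect r1 m1 j != 0.
  apply/existsP; apply: contraNT nohit => /existsPn good.
  apply: (good_hit (m1 := m1)) => [j|u|u a].
  - by have := good j; rewrite negbK => /eqP.
  - by have /and5P[_ _ _ /implyP h _] := ok_node ok0 u.
  - by have /and5P[_ _ _ _ /forallP h] := ok_node ok0 u.
have sub : [set r2 | all_ok r1 r2 m1 (Q2 r2)] \subset
           [set r2 : coins | root (defect r1 m1 j) (coin_point (r2 v))].
  by apply/subsetP => r2; rewrite !inE => ok; apply: (ok_defect ok).
have := card_coins_root v dj (size_defect r1 m1 j).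
have := subset_leq_card sub.
set N := #|[set r2 : coins | root _ _]|; set N' := #|[set r2 | _]| => N'N.
have q0 : (0 < q)%N by apply/card_gt0P; exists 0.
move=> qN; rewrite -(leq_pmul2l q0).
apply: leq_trans (_ : 16 * ((M + M + M) * #|{: coins}|) <= _)%N; last first.
  by rewrite mulnA leq_mul2r Mq orbT.
by rewrite mulnCA leq_mul2l /= (leq_trans _ qN) // leq_mul2l N'N orbT.
Qed.

(** Acceptance has probability at most [1/4 + 1/16 = 5/16], below 1/3. *)
Lemma protocol_sound : (64 <= 2 ^ k)%N -> (16 * (M + M + M) <= q)%N -> ~ Asym e ->
  forall Q1 Q2, (3 * #|accepted Q1 Q2| < #|{: coins}| * #|{: coins}|)%N.
Proof.
move=> k64 Mq nasym Q1 Q2; set H := [set r1 | [exists tau, hit e B (seed_of r1) tau]].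
have H4 : (4 * #|H| <= #|{: coins}|)%N := card_hit_coins k64 nasym.
rewrite (card_set_pair (fun r1 r2 => all_ok r1 r2 (Q1 r1) (Q2 r1 r2))).
have : (16 * \sum_(r1 : coins) #|[set r2 | all_ok r1 r2 (Q1 r1) (Q2 r1 r2)]| <=
        #|{: coins}| * #|{: coins}| + 16 * (#|H| * #|{: coins}|))%N.
  rewrite -!sum_nat_const.
  rewrite [X in (_ <= _ + 16 * X)%N]big_mkcond !big_distrr -big_split /=.
  apply: leq_sum => r1 _; have [r1H|] := boolP (r1 \in H).
    by apply: leq_trans (leq_addl _ _); rewrite leq_mul2l max_card.
  by rewrite inE => nohit; rewrite muln0 addn0 ok_few.
have := coins_gt0; move: H4; move: (\sum_r1 _)%N #|H| #|{: coins}| => X h N.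
by nia.
Qed.

End Protocol.

(** * Translation to bit strings *)

Section Encoding.
Variable l : nat.

Lemma card_bits : #|{: l.-tuple bool}| = (2 ^ l)%N.
Proof. by rewrite card_tuple card_bool. Qed.

Section Coins.
Variables (C : finType) (C_card : #|C| = (2 ^ l)%N).

(** Coins are translated by a bijection to keep them uniform; messages only require an injection. *)
Definition bits_coin (t : l.-tuple bool) : C :=
  enum_val (cast_ord (etrans card_bits (esym C_card)) (enum_rank t)).

Definition coin_bits (c : C) : l.-tuple bool :=
  enum_val (cast_ord (etrans C_card (esym card_bits)) (enum_rank c)).

Lemma bits_coinK : cancel bits_coin coin_bits.
Proof. by move=> t; rewrite /coin_bits enum_valK cast_ord_comp cast_ord_id enum_rankK. Qed.

Lemma coin_bitsK : cancel coin_bits bits_coin.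
Proof. by move=> c; rewrite /bits_coin enum_valK cast_ord_comp cast_ord_id enum_rankK. Qed.

End Coins.

Section Messages.
Variables (T : finType) (t0 : T) (T_card : (#|T| <= 2 ^ l)%N).

Definition encode (t : T) : seq bool :=
  enum_val (cast_ord (esym card_bits) (widen_ord T_card (enum_rank t))) : l.-tuple bool.

(** Strings outside the code fall back to [t0], so every prover string denotes a message. *)
Definition decode (s : seq bool) : T := odflt t0 [pick t | encode t == s].

Lemma size_encode t : size (encode t) = l.
Proof. exact: size_tuple. Qed.

Lemma encodeK : cancel encode decode.
Proof.
move=> t; rewrite /decode; case: pickP => [t' /eqP|/(_ t)]; last by rewrite eqxx.
move/val_inj/enum_val_inj/cast_ord_inj/(congr1 val) => /= /val_inj.
exact: enum_rank_inj.
Qed.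

End Messages.

Section Transfer.
Variables (C T1 T2 : finType) (C_card : #|C| = (2 ^ l)%N).
Variables (x1 : T1) (x2 : T2) (T1_card : (#|T1| <= 2 ^ l)%N) (T2_card : (#|T2| <= 2 ^ l)%N).
Variable ok : nat -> C -> C -> T1 -> T2 -> seq (nat * T1 * T2) -> bool.
Local Notation dec1 := (decode x1 T1_card).
Local Notation dec2 := (decode x2 T2_card).

Definition bit_decider : decider l := fun i c1 c2 s1 s2 nb =>
  ok i (bits_coin C_card c1) (bits_coin C_card c2) (dec1 s1) (dec2 s2)
    [seq (y.1.1, dec1 y.1.2, dec2 y.2) | y <- nb].

Variables (n : nat) (id : 'I_n -> nat) (port : 'I_n -> seq 'I_n).

Definition accepted (Q1 : {ffun 'I_n -> C} -> 'I_n -> T1)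
    (Q2 : {ffun 'I_n -> C} -> {ffun 'I_n -> C} -> 'I_n -> T2) :=
  [set rr : {ffun 'I_n -> C} * {ffun 'I_n -> C} |
    [forall v, ok (id v) (rr.1 v) (rr.2 v) (Q1 rr.1 v) (Q2 rr.1 rr.2 v)
       [seq (id u, Q1 rr.1 u, Q2 rr.1 rr.2 u) | u <- port v]]].

Definition coins_of (r : coins n l) : {ffun 'I_n -> C} := [ffun v => bits_coin C_card (r v)].

Definition bits_of (r : {ffun 'I_n -> C}) : coins n l := [ffun v => coin_bits C_card (r v)].

Lemma coins_ofK : cancel coins_of bits_of.
Proof. by move=> r; apply/ffunP => v; rewrite !ffunE bits_coinK. Qed.

Lemma bits_ofK : cancel bits_of coins_of.
Proof. by move=> r; apply/ffunP => v; rewrite !ffunE coin_bitsK. Qed.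

Lemma accept_prob_transfer P1 P2 Q1 Q2 :
  (forall r v, dec1 (P1 r v) = Q1 (coins_of r) v) ->
  (forall r r' v, dec2 (P2 r r' v) = Q2 (coins_of r) (coins_of r') v) ->
  accept_prob bit_decider id port P1 P2 =
    #|accepted Q1 Q2|%:R / (#|{: {ffun 'I_n -> C}}| * #|{: {ffun 'I_n -> C}}|)%:R.
Proof.
move=> P1E P2E; rewrite /accept_prob -card_prod; congr (_%:R / _%:R); last first.
  by rewrite !card_prod !card_ffun card_bits C_card.
pose g (rr : coins n l * coins n l) := (coins_of rr.1, coins_of rr.2).
have g_bij : bijective g.
  exists (fun rr => (bits_of rr.1, bits_of rr.2)) => -[r r'];
  by rewrite /g /= ?coins_ofK ?bits_ofK.
rewrite -(on_card_preimset (f := g) (R := accepted Q1 Q2)); last exact: onW_bij.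
apply: eq_card => -[r r']; rewrite !inE /all_accept /bit_decider /=.
apply: eq_forallb => v; rewrite !ffunE P1E P2E -map_comp; congr ok.
by apply: eq_map => u /=; rewrite P1E P2E.
Qed.

Lemma protocol_transfer (asym : Prop) :
  (asym -> exists Q1 Q2, (2 * (#|{: {ffun 'I_n -> C}}| * #|{: {ffun 'I_n -> C}}|)
                          < 3 * #|accepted Q1 Q2|)%N) ->
  (~ asym -> forall Q1 Q2, (3 * #|accepted Q1 Q2|
                          < #|{: {ffun 'I_n -> C}}| * #|{: {ffun 'I_n -> C}}|)%N) ->
  (asym -> exists P1 P2, prover_bounded P1 P2 /\
              2%:R / 3%:R < accept_prob bit_decider id port P1 P2) /\
  (~ asym -> forall P1 P2, prover_bounded P1 P2 ->
              accept_prob bit_decider id port P1 P2 < 1%:R / 3%:R).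
Proof.
have N0 : (0 < #|{: {ffun 'I_n -> C}}| * #|{: {ffun 'I_n -> C}}|)%N.
  by rewrite muln_gt0 card_ffun C_card -expnM expn_gt0.
set N := (_ * _)%N in N0 *; have NR : (0 : rat) < N%:R by rewrite ltr0n.
move=> complete sound; split=> [/complete[Q1 [Q2 lt]]|/sound lt P1 P2 _].
  exists (fun r v => encode T1_card (Q1 (coins_of r) v)),
         (fun r r' v => encode T2_card (Q2 (coins_of r) (coins_of r') v)).
  split; first by split=> *; rewrite size_encode.
  rewrite (accept_prob_transfer (Q1 := Q1) (Q2 := Q2)) => [|r v|r r' v]; rewrite ?encodeK //.
  rewrite -/N ltr_pdivlMr // mulrAC ltr_pdivrMr ?ltr0n //.
  by rewrite -!natrM ltr_nat [X in (_ < X)%N]mulnC.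
(* Decoding turns any bit-level prover into an abstract one. *)
rewrite (accept_prob_transfer (Q1 := fun r v => dec1 (P1 (bits_of r) v))
  (Q2 := fun r r' v => dec2 (P2 (bits_of r) (bits_of r') v))) => [|r v|r r' v];
  rewrite ?coins_ofK //.
rewrite -/N ltr_pdivrMr // mulrAC ltr_pdivlMr ?ltr0n // mul1r.
by rewrite -natrM ltr_nat mulnC.
Qed.

End Transfer.
End Encoding.

(** * Choice of the field and parameters *)

Lemma Asym_small (n : nat) (e : rel 'I_n) : (n <= 1)%N -> Asym e.
Proof.
move=> n1 s _; apply/permP => i; apply: ord_inj.
by have := ltn_ord (s i); have := ltn_ord i; rewrite perm1; lia.
Qed.

Definition log_size (n : nat) := (trunc_log 2 n).+1.

Definition dAMAM_spec (L : language) (cid n l : nat) (D : decider l) : Prop :=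
  forall (e : rel 'I_n) (id : 'I_n -> nat) (port : 'I_n -> seq 'I_n),
    (0 < n)%N -> simple_graph e -> connected_graph e -> valid_ids cid id ->
    port_numbering e port ->
    (L n e -> exists P1 P2, prover_bounded P1 P2 /\
                 2%:R / 3%:R < accept_prob D id port P1 P2) /\
    (~ L n e -> forall P1 P2, prover_bounded P1 P2 ->
                 accept_prob D id port P1 P2 < 1%:R / 3%:R).

(* With [q = 2 ^ ((cid + 12) * log_size n) >= 512 n^3] and [k = 6], coins and messages
   are at most 35 field elements: 3 + 2 + 6 + 24 for the first prover message. *)
Lemma asym_decider (cid n : nat) :
  {D : decider (35 * (cid + 12) * log_size n) | dAMAM_spec Asym cid n D}.
Proof.
have [n1|n2] := leqP n 1.
  (* With at most one vertex every graph is asymmetric, and [n!^6 = 1] is too small for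
     [exists_box]. *)
  exists (fun _ _ _ _ _ _ => true) => e id port _ _ _ _ _; split; last first.
    by case; apply: Asym_small.
  move=> _; exists (fun _ _ => [::]), (fun _ _ _ => [::]); split; first by [].
  rewrite /accept_prob (_ : [set rr | _] = setT); last first.
    by apply/setP => rr; rewrite !inE; apply/forallP.
  rewrite cardsT divff; first by lra.
  rewrite pnatr_eq0 -lt0n card_prod !card_ffun card_bits.
  by rewrite muln_gt0 !expn_gt0.
set lg := log_size n; set t := ((cid + 12) * lg)%N.
have t0 : (0 < t)%N by rewrite muln_gt0 addn_gt0 orbT.
have [K _ Kcard] := PrimePowerField (erefl : prime 2) t0.
have nlg : (n < 2 ^ lg)%N by apply: trunc_log_ltn.
(* This covers [12 n^3] for the sketch collisions and [16 * 18n] for the root test. *)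
have nq : (512 * n ^ 3 <= #|K|)%N.
  rewrite Kcard /t mulnDl expnD (leq_trans _ (leq_pmull _ _)) ?expn_gt0 //.
  rewrite (_ : 12 * lg = 9 * lg + lg * 3)%N; last by lia.
  rewrite expnD; apply: leq_mul; last by rewrite expnM leq_exp2r // ltnW.
  by rewrite -[512%N]/(2 ^ 9)%N leq_exp2l // leq_pmulr.
have n_pos : (0 < n)%N by apply: leq_trans n2.
have n1q : (n <= #|K|)%N by apply: leq_trans nq; nia.
have q0 : (0 < #|K|)%N by apply: leq_trans n1q.
have fact_q : (n`! ^ 6 <= 8 * #|K| ^ (6 * n))%N.
  have fact_le m : (m <= n)%N -> (m`! <= #|K| ^ m)%N.
    elim: m => [|m IH] mn; first by rewrite expn0.
    by rewrite factS expnS leq_mul ?(leq_trans mn) // IH // ltnW.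
  rewrite (leq_trans _ (leq_pmull _ _)) // mulnC expnM leq_exp2r //.
  exact: fact_le.
have fact_8 : (8 <= n`! ^ 6)%N.
  have : (2 <= n`!)%N by rewrite (leq_trans n2) // fact_geq.
  by move=> h; apply: leq_trans (_ : 2 ^ 6 <= _)%N => //; rewrite leq_exp2r.
have /sigW[B boxB] := exists_box fact_8 fact_q.
(* One point, 24 family entries and 10 padding elements give exactly 35 field elements. *)
pose pad : finType := {ffun 'I_10 -> K}.
have coin_card : #|coin K 6 pad| = (2 ^ (35 * (cid + 12) * lg))%N.
  rewrite -mulnA [(35 * _)%N]mulnC expnM -Kcard.
  rewrite !card_prod !card_ffun !card_ord -!expnD -expnS.
  by rewrite -expnD.
have msg1_card : (#|msg1 K 6 n| <= 2 ^ (35 * (cid + 12) * lg))%N.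
  rewrite -mulnA [(35 * _)%N]mulnC expnM -Kcard.
  rewrite !card_prod !card_ffun !card_ord.
  have n6q : (n ^ 6 <= #|K| ^ 6)%N by rewrite leq_exp2r.
  apply: leq_trans (leq_mul (leq_mul (leq_mul (leq_mul (leqnn _) n1q) n1q) n6q) (leqnn _)) _.
  by rewrite mulnn -!expnSr -!expnD.
have msg2_card : (#|msg2 K 6| <= 2 ^ (35 * (cid + 12) * lg))%N.
  rewrite -mulnA [(35 * _)%N]mulnC expnM -Kcard.
  rewrite !card_prod card_ffun mulnn -!expnSr -expnD leq_pexp2l //.
  by rewrite (leq_trans (leq_add (leqnn _) (card_check 6))).
pose o : 'I_n := Ordinal n_pos; pose oq : 'I_#|K| := Ordinal q0.
pose x1 : msg1 K 6 n :=
  (oq, oq, oq, o, o, [ffun=> o], ([ffun=> 0], [ffun=> 0], [ffun=> 0], [ffun=> 0])).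
pose x2 : msg2 K 6 := (0, 0, 0, [ffun=> 0]).
exists (bit_decider coin_card x1 x2 msg1_card msg2_card (@node_ok K 6 n pad B)).
move=> e id port _ [e_sym _] conn [id_inj id_lt] portP.
have id_q v : (id v < #|K|)%N.
  apply: leq_trans (id_lt v) _; rewrite Kcard leq_exp2l //.
  by rewrite leq_mul2r leq_addr orbT.
have pad0 : (0 < #|pad|)%N by rewrite card_ffun expn_gt0 q0.
apply: protocol_transfer => [asym|nasym].
  by apply: (protocol_complete e_sym conn id_inj id_q portP) => //; nia.
by apply: (protocol_sound e_sym conn id_inj) => //; nia.
Qed.

Theorem mainTheorem2 : in_dAMAM_log Asym.
Proof.
move=> cid; exists (35 * (cid + 12))%N, (fun n => 35 * (cid + 12) * log_size n)%N.
exists (fun n => sval (asym_decider cid n)); split=> // n.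
exact: (svalP (asym_decider cid n)).
Qed.
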